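(* Let $G$ be a countable group acting deeply transitively (by homeomorphisms) on a Cantor set $X$. Then all of the following hold: (1) The action of $G$ on $X$ is IC-rigid. (2) If $\mathcal{M}_G(X)=\emptyset$, then the induced action of $G$ on $\mathcal{K}(X)$ is uniquely ergodic with unique invariant Borel probability measure $\delta_X$. (3) If $\mathcal{M}_G(X)\neq\emptyset$, then the simplex $\mathcal{M}_G(\mathcal{K}(X))$ is isomorphic (as a convex set, i.e. via an affine bijection) to the infinite-dimensional probability simplex $\Delta(\mathbb{N})=\{(x_i)_{i=0}^{\infty} : x_i\ge 0 \text{ for all } i \text{ and } \sum_{i=0}^{\infty}x_i=1\}$.
   Context: Let $X$ be a Cantor set with a compatible metric. For a compact metric space $Z$ with a continuous $G$-action, $\mathcal{M}_G(Z)$ is the set of $G$-invariant Borel probability measures on $Z$. Invariant random compacts. $\mathcal{K}(X)$ is the space of nonempty compact subsets of $X$ with the Hausdorff metric, and $G$ acts on it by $g\cdot A=g(A)$. An invariant random compact (IRC) is a $G$-invariant Borel probability measure on $\mathcal{K}(X)$. $\mathcal{K}_{\mathrm{fin}}(X)\subset\mathcal{K}(X)$ is the set of nonempty finite subsets. An IRC $\mu$ is nonfinitary if $\mu(\mathcal{K}_{\mathrm{fin}}(X))=0$. $\delta_X$ is the Dirac mass at the point $X\in\mathcal{K}(X)$. The action is IC-rigid if the only nonfinitary IRC is $\delta_X$. Tree structures. A tree structure for $X$ is a sequence of finite clopen partitions $\mathcal{C}_i=\{C^i_1,\dots,C^i_{\kappa(i)}\}$, $i\ge 1$, of $X$ (into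 nonempty sets) such that: (a) $\mathcal{C}_{i+1}$ refines $\mathcal{C}_i$ for every $i$; (b) $\max\{\operatorname{diam}(C): C\in\mathcal{C}_i\}\to 0$ as $i\to\infty$; (c) for all $k\ge1$ and $C\in\mathcal{C}_k$, $\inf_{n\ge k}\frac{|\{D\in\mathcal{C}_n: D\subset C\}|}{\kappa(n)}>0$. The action of $G$ is deeply transitive with respect to $(\mathcal{C}_i)$ if for each $i\ge1$, each $1\le r\le\kappa(i)$, and all pairs of $r$-element subsets $\{A_1,\dots,A_r\},\{B_1,\dots,B_r\}$ of $\mathcal{C}_i$, there is $g\in G$ with $\{g(A_1),\dots,g(A_r)\}=\{B_1,\dots,B_r\}$. $G$ acts deeply transitively on $X$ if there is a tree structure with respect to which the action is deeply transitive. *)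

(* Defs.v *)
From HB Require Import structures.
From mathcomp Require Import all_boot all_order all_algebra.
From mathcomp Require Import finmap.
From mathcomp Require Import all_classical all_reals all_analysis.
From mathcomp Require Import giry.

Set Implicit Arguments.
Unset Strict Implicit.
Unset Printing Implicit Defensive.

Import Order.TTheory GRing.Theory Num.Theory.
Import numFieldNormedType.Exports.

Local Open Scope classical_set_scope.
Local Open Scope ring_scope.

(* A point is needed because Borel sigma-algebras ([g_sigma_algebraType]) are
   only measurable types over a pointed carrier. *)
#[short(type="pmetricType")]
HB.structure Definition PointedMetric (R : numDomainType) :=
  {M of Metric R M & Pointed M}.

(* Continuous left actions of a discrete group; each [act a g] is then a
   homeomorphism with inverse [act a g^-1]. *)
Record action (G : groupType) (Z : topologicalType) := Action {
  act :> G -> Z -> Z ;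
  act1 : forall x, act 1%g x = x ;
  actM : forall g h x, act (g * h)%g x = act g (act h x) ;
  act_continuous : forall g, continuous (act g) }.

Notation borel Z := (g_sigma_algebraType (@open Z)).

Section invariant_probabilities.
Context (R : realType) (G : groupType) (Z : ptopologicalType).

Definition invariant_probabilities (a : action G Z) :
    set (probability (borel Z) R) :=
  [set mu | forall g (B : set (borel Z)), measurable B ->
    mu (a g @^-1` B) = mu B].

(* Library measures are functions on all sets, so two of them are the same
   measure when they are equal on measurable sets, i.e. [mu ≡μ nu]. *)
Definition uniquely_ergodic_at (a : action G Z)
    (mu : probability (borel Z) R) :=
  invariant_probabilities a mu /\
  forall nu, invariant_probabilities a nu -> nu ≡μ mu.

End invariant_probabilities.
Arguments invariant_probabilities R {G Z} a.

Section convex_combination_of_probabilities.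
Local Open Scope ereal_scope.
Context d (T : measurableType d) (R : realType).
Variables (t : {i01 R}) (mu nu : probability T R).

Definition prob_conv (A : set T) : \bar R :=
  (t%:num)%:E * mu A + (1 - t%:num)%:E * nu A.

Let t0 : 0 <= (t%:num)%:E. Proof. by rewrite lee_fin. Qed.

Let t1 : 0 <= (1 - t%:num)%:E.
Proof. by rewrite lee_fin subr_ge0. Qed.

Let prob_conv0 : prob_conv set0 = 0.
Proof. by rewrite /prob_conv !measure0 !mule0 adde0. Qed.

Let prob_conv_ge0 A : 0 <= prob_conv A.
Proof. by rewrite adde_ge0// mule_ge0. Qed.

Let prob_conv_semi_sigma_additive : semi_sigma_additive prob_conv.
Proof.
have t0' : (0 <= t%:num :> R)%R by [].
have t1' : (0 <= 1 - t%:num :> R)%R by rewrite subr_ge0.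
pose m := measure_add (mscale (NngNum t0') mu)
  (mscale (NngNum t1') nu).
rewrite (_ : prob_conv = m); first exact: measure_semi_sigma_additive.
by apply/funext => A; rewrite /m measure_addE.
Qed.

HB.instance Definition _ := isMeasure.Build _ _ _ prob_conv
  prob_conv0 prob_conv_ge0 prob_conv_semi_sigma_additive.

Let prob_conv_setT : prob_conv setT = 1.
Proof.
by rewrite /prob_conv !probability_setT !mule1 -EFinD addrC subrK.
Qed.

HB.instance Definition _ :=
  Measure_isProbability.Build _ _ _ prob_conv prob_conv_setT.

End convex_combination_of_probabilities.

Definition simplex (R : realType) : set (nat -> R) :=
  [set x | (forall i, 0 <= x i) /\ series x @ \oo --> (1 : R)].
Arguments simplex : clear implicits.

(* [M] is a set of probability measures considered up to [≡μ]; the second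
   clause says that [Phi] is well defined and injective on classes. *)
Definition affinely_isomorphic (R : realType) d (T : measurableType d)
    (M : set (probability T R)) (D : set (nat -> R)) :=
  exists Phi : probability T R -> nat -> R,
  [/\ forall mu, M mu -> D (Phi mu),
      forall mu nu, M mu -> M nu -> Phi mu = Phi nu <-> mu ≡μ nu,
      forall x, D x -> exists2 mu, M mu & Phi mu = x &
      forall (t : {i01 R}) mu nu, M mu -> M nu -> forall i,
        Phi (prob_conv t mu nu) i =
        t%:num * Phi mu i + (1 - t%:num) * Phi nu i].

Definition cpt (R : realType) (X : pmetricType R) : Type :=
  {A : set X | compact A /\ A !=set0}.

Section hyperspace.
Context (R : realType) (X : pmetricType R).
Implicit Types A B C : cpt X.

Definition hausdorff_radii A B : set R :=
  [set e | [/\ 0 < e, sval A `<=` \bigcup_(b in sval B) ball b e &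
                      sval B `<=` \bigcup_(a in sval A) ball a e]].

Definition hausdorff_dist A B : R := inf (hausdorff_radii A B).

Lemma compact_ball_bound (A : set X) (b : X) : compact A ->
  exists2 e : R, 0 < e & A `<=` ball b e.
Proof.
move=> /compact_near_coveringP.
move=> /(_ R (+oo_R) (fun e x => ball b e x) _) cA.
have := cA _; case=> [x Ax|M [_ HM]].
  exists (ball x 1, [set e | mdist b x + 1 < e]).
    split=> /=; first exact: nbhsx_ballx.
    by exists (mdist b x + 1); split => //; rewrite num_real.
  move=> [y e] /= []; rewrite !ballEmdist /= => xy be.
  by rewrite (le_lt_trans (metric_triangle b x y))// (lt_trans _ be)// ltrD2l.
exists (Num.max M 0 + 1); first by rewrite ltr_wpDl// le_max lexx orbT.
by apply: HM; rewrite ltr_pwDr// le_max lexx.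
Qed.

Lemma hausdorff_radii_nonempty A B : hausdorff_radii A B !=set0.
Proof.
have [cA [a Aa]] := svalP A; have [cB [b Bb]] := svalP B.
have [e e0 Ae] := compact_ball_bound b cA.
have [f f0 Bf] := compact_ball_bound a cB.
exists (Num.max e f); split; first by rewrite lt_max e0.
- move=> x /Ae bx; exists b => //; apply: le_ball bx.
  by rewrite le_max lexx.
- move=> x /Bf ax; exists a => //; apply: le_ball ax.
  by rewrite le_max lexx orbT.
Qed.

Lemma hausdorff_radii_lbound0 A B : lbound (hausdorff_radii A B) 0.
Proof. by move=> e [/ltW]. Qed.

Lemma hausdorff_radii_has_inf A B : has_inf (hausdorff_radii A B).
Proof.
split; first exact: hausdorff_radii_nonempty.
by exists 0; exact: hausdorff_radii_lbound0.
Qed.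

Lemma hausdorff_dist_ge0 A B : 0 <= hausdorff_dist A B.
Proof.
apply: lb_le_inf; first exact: hausdorff_radii_nonempty.
exact: hausdorff_radii_lbound0.
Qed.

Lemma hausdorff_dist_le A B e : hausdorff_radii A B e ->
  hausdorff_dist A B <= e.
Proof. by move=> ABe; apply: ge_inf => //; case: (hausdorff_radii_has_inf A B). Qed.

Lemma hausdorff_dist_lt A B e :
  hausdorff_dist A B < e -> hausdorff_radii A B e.
Proof.
move=> /(inf_lt (hausdorff_radii_nonempty A B)) [d [d0 AB BA] de].
split; first exact: lt_trans de.
- by move=> x /AB [y By yx]; exists y => //; exact: le_ball (ltW de) _ yx.
- by move=> x /BA [y By yx]; exists y => //; exact: le_ball (ltW de) _ yx.
Qed.

Lemma hausdorff_distxx A : hausdorff_dist A A = 0.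
Proof.
apply/eqP; rewrite eq_le hausdorff_dist_ge0 andbT.
apply/ler_addgt0Pl => e e0; rewrite addr0.
by apply: hausdorff_dist_le; split => // x Ax; exists x => //; exact: ballxx.
Qed.

Lemma hausdorff_dist_sym A B : hausdorff_dist A B = hausdorff_dist B A.
Proof.
by congr (inf _); apply/seteqP; split => e [].
Qed.

Lemma cpt_eq A B : sval A = sval B -> A = B.
Proof.
case: A B => [A Ap] [B Bp] /= AB; subst B.
by congr exist; exact: Prop_irrelevance.
Qed.

Lemma hausdorff_dist_positivity A B : hausdorff_dist A B = 0 -> A = B.
Proof.
suff sub C D : hausdorff_dist C D = 0 -> sval C `<=` sval D.
  move=> AB0; apply: cpt_eq.
  by apply/seteqP; split; apply: sub => //; rewrite hausdorff_dist_sym.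
move=> CD0 x Cx; have [cD _] := svalP D.
have /closure_id -> := compact_closed (@metric_hausdorff _ X) cD.
move=> U /nbhs_ballP[e /= e0 xeU].
have [] := @hausdorff_dist_lt C D e; first by rewrite CD0.
move=> _ /(_ x Cx)[y Dy yx] _.
by exists y; split => //; apply: xeU; exact: ball_sym.
Qed.

Lemma hausdorff_dist_triangle B A C :
  hausdorff_dist A C <= hausdorff_dist A B + hausdorff_dist B C.
Proof.
apply/ler_addgt0Pl => e e0.
rewrite [e]splitr addrACA.
have [] := @hausdorff_dist_lt A B (e / 2 + hausdorff_dist A B).
  by rewrite ltrDr divr_gt0.
set r := _ + _ => r0 AB BA.
have [] := @hausdorff_dist_lt B C (e / 2 + hausdorff_dist B C).
  by rewrite ltrDr divr_gt0.
set s := _ + _ => s0 BC CB.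
apply: hausdorff_dist_le; split; first by rewrite addr_gt0.
- move=> x /AB[y /BC[z Cz zy] yx]; exists z => //.
  by rewrite addrC; exact: ball_triangle zy yx.
- move=> x /CB[y /BA[z Cz zy] yx]; exists z => //.
  by exact: ball_triangle zy yx.
Qed.

HB.instance Definition _ := gen_eqMixin (cpt X).
HB.instance Definition _ := gen_choiceMixin (cpt X).
HB.instance Definition _ := isMetric.Build R (cpt X)
  hausdorff_distxx hausdorff_dist_positivity hausdorff_dist_sym
  hausdorff_dist_triangle.

Definition cpt_set1 (x : X) : cpt X :=
  exist _ [set x] (conj (@compact_set1 _ x) (ex_intro _ x erefl)).

HB.instance Definition _ := isPointed.Build (cpt X) (cpt_set1 point).

Lemma cpt_image_subproof (f : X -> X) (cf : continuous f) A :
  compact (f @` sval A) /\ f @` sval A !=set0.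
Proof.
have [cA A0] := svalP A; split; last exact: image_nonempty.
by apply: continuous_compact => //; exact: continuous_subspaceT.
Qed.

Definition cpt_image (f : X -> X) (cf : continuous f) A : cpt X :=
  exist _ (f @` sval A) (cpt_image_subproof cf A).

Lemma cpt_image_continuous (f : X -> X) (cf : continuous f) :
  continuous (cpt_image cf).
Proof.
move=> A U /nbhs_ballP[e /= e0 eU].
have [/compact_near_coveringP cA _] := svalP A.
have e20 : 0 < e / 2 by rewrite divr_gt0.
have := cA R 0^'+ (fun d x => forall y, ball x d y -> ball (f x) (e / 2) (f y)) _.
case=> [x Ax|d /= d0 dA].
  have e40 : 0 < e / 2 / 2 by rewrite divr_gt0.
  have /nbhs_ballP[d /= d0 xd] : \forall y \near x, ball (f x) (e / 2 / 2) (f y).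
    by move/cvg_ballP : (cf x); apply.
  have d20 : 0 < d / 2 by rewrite divr_gt0.
  exists (ball x (d / 2), [set r | r < d / 2]).
    by split=> /=; [exact: nbhsx_ballx|exact: nbhs_right_lt].
  move=> [z r] /= [xz rd] y zy; rewrite [e / 2]splitr.
  apply: (@ball_triangle _ _ (f x)); first last.
    apply: xd; rewrite [d]splitr; apply: ball_triangle xz _.
    exact: le_ball (ltW rd) _ zy.
  apply: ball_sym; apply: xd; apply: le_ball xz.
  by rewrite ler_pdivrMr// ler_peMr ?ler1n// ltW.
have d20 : 0 < d / 2 by rewrite divr_gt0.
have {}dA : forall x, sval A x -> forall y, ball x (d / 2) y ->
    ball (f x) (e / 2) (f y).
  apply: dA => //=; rewrite sub0r normrN gtr0_norm//.
  by rewrite ltr_pdivrMr// ltr_pMr// ltr1n.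
apply/nbhs_ballP; exists (d / 2) => //= B.
rewrite ballEmdist /= => /hausdorff_dist_lt [_ AB BA].
apply: eU; rewrite ballEmdist /=; apply: (@le_lt_trans _ _ (e / 2)); last first.
  by rewrite ltr_pdivrMr// ltr_pMr// ltr1n.
apply: hausdorff_dist_le; split => //.
- move=> _ [x Ax <-]; have [y By yx] := AB x Ax.
  exists (f y); first by exists y.
  by apply: ball_sym; apply: dA => //; exact: ball_sym.
- move=> _ [y By <-]; have [x Ax xy] := BA y By.
  by exists (f x); [exists x|exact: dA].
Qed.

End hyperspace.

Program Definition hyper_action (R : realType) (X : pmetricType R)
    (G : groupType) (a : action G X) : action G (cpt X) :=
  @Action G (cpt X) (fun g => cpt_image (@act_continuous _ _ a g)) _ _ _.
Next Obligation.
move=> R X G a A; apply: cpt_eq => /=.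
by under eq_imagel do rewrite act1; rewrite image_id.
Qed.
Next Obligation.
move=> R X G a g h A; apply: cpt_eq => /=.
by rewrite image_comp; apply: eq_imagel => x _ /=; rewrite actM.
Qed.
Next Obligation. by move=> R X G a g; exact: cpt_image_continuous. Qed.

Lemma whole_cpt_subproof (R : realType) (X : pmetricType R) :
  cantor_like X -> compact [set: X] /\ [set: X] !=set0.
Proof. by case=> _ cX _ _; split => //; exists point. Qed.

Definition whole_cpt (R : realType) (X : pmetricType R) (hX : cantor_like X) :
  cpt X := exist _ [set: X] (whole_cpt_subproof hX).

Definition dirac_whole (R : realType) (X : pmetricType R)
    (hX : cantor_like X) : probability (borel (cpt X)) R :=
  \d_(whole_cpt hX : borel (cpt X)).

Definition finite_cpts (R : realType) (X : pmetricType R) : set (cpt X) :=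
  [set A | finite_set (sval A)].

Section invariant_random_compacts.
Context (R : realType) (X : pmetricType R) (hX : cantor_like X).
Context (G : groupType) (a : action G X).

Definition IRC : set (probability (borel (cpt X)) R) :=
  invariant_probabilities R (hyper_action a).

Definition nonfinitary (mu : probability (borel (cpt X)) R) :=
  mu (@finite_cpts R X) = 0%E.

Definition IC_rigid :=
  forall mu : probability (borel (cpt X)) R,
    IRC mu /\ nonfinitary mu <->
    mu ≡μ dirac_whole hX.

End invariant_random_compacts.

Section tree_structures.
Context (R : realType) (X : pmetricType R).

Definition diam (A : set X) : R :=
  sup [set mdist p.1 p.2 | p in A `*` A].

Definition descendant_ratio (C : nat -> {fset set X}) (A : set X) (n : nat)
    : R :=
  (#|` [fset D in C n | `[< (D `<=` A)%classic >]]%fset|)%:R / (#|` C n|)%:R.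

(* The sequence starts at index 0 instead of 1. *)
Definition tree_structure (C : nat -> {fset set X}) :=
  [/\ forall i, partition [set` C i] id [set: X] /\
                forall A : set X, A \in C i -> clopen A,
      forall i (D : set X), D \in C i.+1 ->
        exists2 A : set X, A \in C i & D `<=` A,
      (\big[Num.max/0]_(A <- C i) diam A) @[i --> \oo] --> (0 : R) &
      forall k (A : set X), A \in C k ->
        0 < inf [set descendant_ratio C A n | n in [set n | (k <= n)%N]]].

Definition deeply_transitive_wrt (G : groupType) (a : action G X)
    (C : nat -> {fset set X}) :=
  forall i r, (1 <= r <= #|` C i|)%N ->
  forall S T : {fset set X}, (S `<=` C i)%fset -> (T `<=` C i)%fset ->
    #|` S| = r -> #|` T| = r ->
    exists g, [fset (a g @` A)%classic | A in S]%fset = T.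

Definition deeply_transitive (G : groupType) (a : action G X) :=
  exists2 C, tree_structure C & deeply_transitive_wrt a C.

End tree_structures.

(* Main.v *)
Require Import Defs.
From HB Require Import structures.
From mathcomp Require Import all_boot all_order all_algebra.
From mathcomp Require Import finmap.
From mathcomp Require Import all_classical all_reals all_analysis.
From mathcomp Require Import giry measurable_realfun.
From mathcomp Require Import lra.

(** A random compact set is read through its footprints: at each level of the
tree, the set of cells that it meets. Events about footprints generate the
Borel sigma-algebra of the hyperspace, and deep transitivity says that an
invariant law gives the same mass to any two footprints with the same number
of cells ([level_mass_exchangeable]). At each level, an invariant law is thus
a mixture of the uniform laws on the sets of [r] cells, and only the law of
the number of cells is free.

On infinite compact sets, the size of the footprint tends to infinity with the
level. A uniform set of [r] cells misses all the descendants of a given cell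
[c] with probability at most [z ^+ r], where [z < 1] bounds, at all levels,
the proportion of the cells that lie outside [c]; such a [z] is what the
density condition on tree structures provides. When [r] grows, [c] is seen to
be met almost surely ([missing_cell_null]). So the whole space is the only
infinite compact set that an invariant law can charge, which is the rigidity
claim.

On the compact sets with exactly [r.+1] points, the footprint has [r.+1] cells
from some level on. The uniform laws on sets of [r.+1] cells depend on the tree
alone, hence two invariant measures that live on these sets and have the same
total mass agree in the limit ([invariant_mass_unique]). An invariant law is
therefore determined by its masses on countably many strata: the whole space,
and the sets with [r.+1] points for each [r] ([IRC_unique]).

If a stratum of finite sets is charged, then the mean number of points that
fall in a Borel set is, once normalized, an invariant probability on the space
([invariant_of_stratum]); this gives the claim of unique ergodicity. Conversely,
an invariant probability [lambda] on the space makes the set of [r.+1]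
independent points of law [lambda] an invariant random compact. These points
are almost surely distinct, since [lambda] spreads equally over the cells of a
level, whose number is unbounded ([sample_law_few]). Every stratum then
carries an invariant law, and the masses of the strata are the coordinates of
an affine bijection onto the simplex, whose surjectivity is obtained by mixing
these laws ([stratum_mass_surj]). *)

Set Implicit Arguments.
Unset Strict Implicit.
Unset Printing Implicit Defensive.

Import Order.TTheory GRing.Theory Num.Theory.
Import numFieldNormedType.Exports.

Local Open Scope classical_set_scope.
Local Open Scope ring_scope.

(** * Basic open sets of the hyperspace *)

Section hyperspace_topology.
Context (R : realType) (X : pmetricType R).

Definition inside (U : set X) : set (cpt X) := [set A | sval A `<=` U].
Definition hits (U : set X) : set (cpt X) := [set A | sval A `&` U !=set0].

(** A radius that works at a point, once halved, works on a neighbourhood of this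
point; compactness of [K] then provides a common radius. *)
Lemma compact_uniform_ball (K U : set X) : compact K -> open U -> K `<=` U ->
  exists2 e : R, 0 < e & forall x, K x -> ball x e `<=` U.
Proof.
move=> /compact_near_coveringP cK oU KU.
have := cK R 0^'+ (fun d x => ball x d `<=` U) _.
case=> [x Kx|d /= d0 dK].
  have /nbhs_ballP[d /= d0 xd] : nbhs x U by apply: open_nbhs_nbhs; split => //; apply: KU.
  have d20 : 0 < d / 2 by rewrite divr_gt0.
  exists (ball x (d / 2), [set r | r < d / 2]).
    by split=> /=; [exact: nbhsx_ballx|exact: nbhs_right_lt].
  move=> [z r] /= [xz rd] y zy; apply: xd; rewrite [d]splitr.
  by apply: ball_triangle xz _; exact: le_ball (ltW rd) _ zy.
exists (d / 2); first by rewrite divr_gt0.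
apply: dK => /=; last by rewrite divr_gt0.
rewrite sub0r normrN gtr0_norm ?divr_gt0//.
by rewrite ltr_pdivrMr// ltr_pMr// ltr1n.
Qed.

Lemma open_inside (U : set X) : open U -> open (inside U).
Proof.
move=> oU; rewrite openE => A AU; have [cA _] := svalP A.
have [e e0 eU] := compact_uniform_ball cA oU AU.
apply/nbhs_ballP; exists e => //= B.
rewrite ballEmdist /= => /hausdorff_dist_lt [_ _ BA] x /BA[y Ay].
exact: eU.
Qed.

Lemma open_hits (U : set X) : open U -> open (hits U).
Proof.
move=> oU; rewrite openE => A [x [Ax Ux]].
have /nbhs_ballP[e /= e0 eU] : nbhs x U by apply: open_nbhs_nbhs.
apply/nbhs_ballP; exists e => //= B.
rewrite ballEmdist /= => /hausdorff_dist_lt [_ AB _].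
have [y By /ball_sym yx] := AB x Ax.
by exists y; split=> //; exact: eU.
Qed.

Lemma insideI (U V : set X) : inside (U `&` V) = inside U `&` inside V.
Proof.
apply/seteqP; split => A; first by move=> AUV; split => x /AUV[].
by move=> [AU AV] x Ax; split; [exact: AU|exact: AV].
Qed.

Lemma measurable_inside (U : set X) : open U ->
  measurable (inside U : set (borel (cpt X))).
Proof. by move=> /open_inside oU; exact: sub_sigma_algebra. Qed.

Lemma measurable_hits (U : set X) : open U ->
  measurable (hits U : set (borel (cpt X))).
Proof. by move=> /open_hits oU; exact: sub_sigma_algebra. Qed.

End hyperspace_topology.

(** * Cells and footprints *)

Section cells.
Context (R : realType) (X : pmetricType R) (cX : compact [set: X]).
Context (C : nat -> {fset set X}) (hC : tree_structure C).

Lemma cell_ex n x : exists c : C n, val c x.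
Proof.
have [/(_ n)[[cov _ _] _] _ _ _] := hC.
have : [set: X] x by []. rewrite -cov => -[c /= cC cx].
by exists [` cC]%fset.
Qed.

Definition cell n x : C n := sval (cid (cell_ex n x)).

Lemma cellP n x : val (cell n x) x.
Proof. exact: svalP (cid (cell_ex n x)). Qed.

Lemma cell_eq n (c : C n) x : val c x -> cell n x = c.
Proof.
move=> cx; have [/(_ n)[[_ tC _] _] _ _ _] := hC.
apply: val_inj; apply: (tC (val (cell n x)) (val c)); rewrite /= ?fsvalP//.
by exists x; split => //; exact: cellP.
Qed.

Lemma cell_surj n (c : C n) : exists x, cell n x = c.
Proof.
have [/(_ n)[[_ _ nC] _] _ _ _] := hC.
have [x cx] := nC (val c) (fsvalP c).
by exists x; exact: cell_eq.
Qed.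

Lemma valE n (c : C n) : val c = [set x | cell n x = c].
Proof.
by apply/seteqP; split => x; [exact: cell_eq|move=> <-; exact: cellP].
Qed.

Lemma cell_refineS n x y : cell n.+1 x = cell n.+1 y -> cell n x = cell n y.
Proof.
have [_ /(_ n) ref _ _] := hC => e.
have [A AC sA] := ref _ (fsvalP (cell n.+1 x)).
rewrite (@cell_eq n [` AC]%fset x) ?(@cell_eq n [` AC]%fset y)//.
  by apply: sA; rewrite e; exact: cellP.
by apply: sA; exact: cellP.
Qed.

Lemma cell_refine m n x y : (m <= n)%N ->
  cell n x = cell n y -> cell m x = cell m y.
Proof.
move=> /subnKC <-; elim: (n - m)%N => [|k IH]; first by rewrite addn0.
by rewrite addnS => /cell_refineS.
Qed.

Lemma mdist_le_diam (A : set X) x y : A x -> A y -> mdist x y <= diam A.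
Proof.
move=> Ax Ay; apply: ub_le_sup; last by exists (x, y).
have [e e0 Xe] := compact_ball_bound (point : X) cX.
exists (e + e) => _ [[u v] /= _ <-].
have /(_ u I) := Xe; have /(_ v I) := Xe; rewrite !ballEmdist/= => pv pu.
by rewrite (le_trans (metric_triangle u point v))// lerD 1?ltW// metric_sym.
Qed.

(** The maximum of the diameters bounds all distances within a cell because the
space is bounded: [diam] is a genuine supremum. *)
Lemma cell_fine (e : R) : 0 < e -> exists N, forall n, (N <= n)%N ->
  forall x y, cell n x = cell n y -> mdist x y < e.
Proof.
move=> e0; have [_ _ /cvgrPdist_lt/(_ e e0)[N _ HN] _] := hC.
exists N => n Nn x y xy; have := HN n Nn.
rewrite /= sub0r normrN => /(le_lt_trans (ler_norm _)); apply: le_lt_trans.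
have xC : val (cell n x) x by exact: cellP.
have yC : val (cell n x) y by rewrite xy; exact: cellP.
apply: (le_trans (mdist_le_diam xC yC)).
exact: (@le_bigmax_seq _ _ _ _ _ _ predT (fun A => diam A)) (fsvalP _) _.
Qed.

Definition cylinder n (S : {set C n}) : set X := [set x | cell n x \in S].

Lemma cylinderC n (S : {set C n}) : ~` cylinder S = cylinder (~: S)%SET.
Proof. by apply/seteqP; split => x; rewrite /cylinder /= inE => /negP. Qed.

Lemma open_cylinder n (S : {set C n}) : open (cylinder S).
Proof.
have [/(_ n)[_ oC] _ _ _] := hC.
rewrite (_ : cylinder S = \bigcup_(c in [set` S]) val c).
  by apply: bigcup_open => c _; have [] := oC _ (fsvalP c).
apply/seteqP; split => [x Sx|x [c /= Sc /cell_eq xc]].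
  by exists (cell n x) => //; exact: cellP.
by rewrite /cylinder /= xc.
Qed.

Lemma clopen_cylinder n (S : {set C n}) : clopen (cylinder S).
Proof.
split; first exact: open_cylinder.
by rewrite -[cylinder S]setCK cylinderC; exact/open_closedC/open_cylinder.
Qed.

(** The trace of [A] at the resolution of level [n]. *)
Definition footprint n (A : set X) : {set C n} :=
  [set c | `[< exists2 x, A x & cell n x = c >]]%SET.

Lemma footprintP n (A : set X) c :
  reflect (exists2 x, A x & cell n x = c) (c \in footprint n A).
Proof. by rewrite inE; exact: asboolP. Qed.

Lemma mem_footprint n (A : set X) x : A x -> cell n x \in footprint n A.
Proof. by move=> Ax; apply/footprintP; exists x. Qed.

Lemma footprint_subset n (A : set X) (S : {set C n}) :
  (footprint n A \subset S) = `[< A `<=` cylinder S >].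
Proof.
apply/fintype.subsetP/asboolP => [AS x Ax|AS c /footprintP[x /AS Sx <-]//].
by apply: AS; exact: mem_footprint.
Qed.

Lemma footprintT n : footprint n setT = [set: C n]%SET.
Proof.
apply/setP => c; rewrite finset.in_setT; have [x <-] := cell_surj c.
exact: mem_footprint.
Qed.

(** The map from the cells of level [n] to the cells of level [m] that contain them
sends the footprint at level [n] onto the footprint at level [m]. *)
Lemma card_footprint_le (A : set X) m n : (m <= n)%N ->
  (#|footprint m A| <= #|footprint n A|)%N.
Proof.
move=> mn; pose p (c : C n) : C m := cell m (sval (cid (cell_surj c))).
suff -> : footprint m A = [set p c | c in footprint n A]%SET.
  exact: leq_imset_card.
have pE x : p (cell n x) = cell m x.
  by apply: (cell_refine mn); exact: svalP (cid (cell_surj (cell n x))).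
apply/setP => c; apply/footprintP/imsetP => [[x Ax <-]|[d /footprintP[x Ax <-] ->]].
  by exists (cell n x); [exact: mem_footprint|rewrite pE].
by exists x => //; rewrite pE.
Qed.

Lemma leq_card_footprint n (A B : set X) : A `<=` B ->
  (#|footprint n A| <= #|footprint n B|)%N.
Proof.
move=> AB; apply: subset_leq_card; rewrite footprint_subset.
by apply/asboolP => x /AB Bx; exact: mem_footprint.
Qed.

Lemma footprint_fset n (B : {fset X}) :
  footprint n [set` B] = [set cell n (val b) | b in [set: B]]%SET.
Proof.
apply/setP => c; apply/footprintP/imsetP => [[x Bx <-]|[b _ ->]].
  by exists [` Bx]%fset.
by exists (val b) => //; exact: fsvalP.
Qed.

Lemma card_footprint_fset n (B : {fset X}) :
  (#|footprint n [set` B]| <= #|` B|)%N.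
Proof.
by rewrite footprint_fset (leq_trans (leq_imset_card _ _))// cardsT cardfE.
Qed.

Lemma separating_level (B : {fset X}) :
  exists N, forall n, (N <= n)%N -> {in B &, injective (cell n)}.
Proof.
(* the least distance between distinct points of B; the bound 1 only keeps e
   positive when B has at most one point *)
pose e : R :=
  \big[Num.min/1]_(p : B * B | p.1 != p.2) mdist (val p.1) (val p.2).
have e0 : 0 < e.
  apply: lt_bigmin => // -[u v] /= uv; rewrite mdist_gt0.
  by apply: contra uv => /eqP/val_inj ->.
have [N HN] := cell_fine e0; exists N => n Nn x y Bx By /(HN _ Nn) xy.
apply/eqP; apply/negP => /negP nxy; move: xy; rewrite ltNge => /negP; apply.
rewrite /e (bigminD1 ([` Bx]%fset, [` By]%fset)) /= ?ge_min ?lexx//.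
Qed.

Lemma card_footprint_separated (B : {fset X}) n :
  {in B &, injective (cell n)} -> #|footprint n [set` B]| = #|` B|.
Proof.
move=> inj; apply/eqP; rewrite eqn_leq card_footprint_fset /=.
rewrite footprint_fset card_in_imset ?cardsT ?cardfE// => u v _ _ uv.
by apply: val_inj; apply: inj => //; exact: fsvalP.
Qed.

(** A clopen set is at a positive distance from its complement, and a cell whose
diameter is smaller than this distance cannot meet both. *)
Lemma clopen_cylinderP (U : set X) : clopen U ->
  exists N, forall n, (N <= n)%N -> U = cylinder (footprint n U).
Proof.
move=> [oU cU]; have cpU : compact U by apply: (subclosed_compact cU cX).
have [e e0 eU] := compact_uniform_ball cpU oU (@subset_refl _ U).
have [N HN] := cell_fine e0; exists N => n Nn; apply/seteqP; split => x.
  exact: mem_footprint.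
move=> /footprintP[y Uy] /(HN _ Nn) yx.
by apply: (eU _ Uy); rewrite ballEmdist.
Qed.

End cells.

(** * Deep transitivity on footprints *)

Section transitivity.
Context (R : realType) (X : pmetricType R).
Context (C : nat -> {fset set X}) (hC : tree_structure C).
Context (G : groupType) (a : action G X).

Lemma act_inj g : injective (a g).
Proof. by move=> x y /(congr1 (a g^-1%g)); rewrite -!actM mulVg !act1. Qed.

(** An element [g] that carries the cells of [S] to the cells of [T] turns meeting
exactly the cells of [S] into meeting exactly the cells of [T]. The statement is
an equivalence, so that it identifies two events about [A]. *)
Lemma footprint_transitive n (S T : {set C n}) : deeply_transitive_wrt a C ->
  #|S| = #|T| -> (0 < #|S|)%N ->
  exists g, forall A, footprint hC n (a g @` A) = T <-> footprint hC n A = S.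
Proof.
move=> ha ST S0.
pose F (V : {set C n}) : {fset set X} := [fset val c | c in V]%fset.
have FC V : (F V `<=` C n)%fset.
  by apply/fsubsetP => _ /imfsetP[c _ ->]; exact: fsvalP.
have cF V : #|` F V| = #|V|.
  by rewrite card_imfset ?cardE//; exact: val_inj.
have [] := ha n #|S| _ (F S) (F T) => //.
  by rewrite S0 -cF fsubset_leq_card.
  by rewrite cF.
move=> g gST; exists g => A.
have ST1 x : cell hC n x \in S ->
    exists2 t, t \in T & a g @` val (cell hC n x) = val t.
  move=> xS; have : a g @` val (cell hC n x) \in F T.
    rewrite -gST; apply/imfsetP; exists (val (cell hC n x)) => //.
    by apply/imfsetP; exists (cell hC n x).
  by move=> /imfsetP[t /= tT e]; exists t.
have TS1 t : t \in T -> exists2 s, s \in S & a g @` val s = val t.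
  move=> tT; have : val t \in F T by apply/imfsetP; exists t.
  by rewrite -gST => /imfsetP[_ /= /imfsetP[s sS ->] ->]; exists s.
have cellg x (s t : C n) : cell hC n x = s -> a g @` val s = val t ->
    cell hC n (a g x) = t.
  move=> <- e; apply: cell_eq; rewrite -e; exists x => //; exact: cellP.
have gcell x (s t : C n) : cell hC n (a g x) = t -> a g @` val s = val t ->
    cell hC n x = s.
  move=> xt e; have : val t (a g x) by rewrite -xt; exact: cellP.
  by rewrite -e => -[y sy /act_inj <-]; exact: cell_eq.
split => e; apply/setP => c; apply/idP/idP.
- move=> /footprintP[x Ax xc].
  have : cell hC n (a g x) \in T by rewrite -e; apply: mem_footprint; exists x.
  by move=> /TS1[s sS es]; rewrite -xc (gcell x s _ erefl es).
- move=> cS; have [y yc] := cell_surj hC c.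
  have [|t tT et] := ST1 y; first by rewrite yc.
  move: tT; rewrite -e => /footprintP[_ [x Ax <-] xt].
  by apply/footprintP; exists x => //; apply: gcell xt _; rewrite -et yc.
- move=> /footprintP[_ [x Ax <-] xc].
  have : cell hC n x \in S by rewrite -e; exact: mem_footprint.
  by move=> /ST1[t tT et]; rewrite -xc (cellg x _ _ erefl et).
- move=> /TS1[s sS es]; move: sS; rewrite -e => /footprintP[x Ax xs].
  by apply/footprintP; exists (a g x); [exists x|exact: cellg xs es].
Qed.

End transitivity.

(** * Cardinality through footprints *)

Section counting_cells.
Context (R : realType) (X : pmetricType R) (cX : compact [set: X]).
Context (C : nat -> {fset set X}) (hC : tree_structure C).
Local Notation footprint := (footprint hC).

(** Any finite set of points is separated at a fine enough level, where each of its
points occupies its own cell; so the footprints of [A] become as large as any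
finite subset of [A]. *)
Lemma counting_le_natP (A : set X) (s : nat) :
  (counting A <= (s%:R : R)%:E)%E <-> forall n, (#|footprint n A| <= s)%N.
Proof.
have fsetP (B : {fset X}) : [set` B] `<=` A ->
    (forall n, (#|footprint n A| <= s)%N) -> (#|` B| <= s)%N.
  move=> BA As; have [N HN] := separating_level cX hC B.
  rewrite -(card_footprint_separated (HN N (leqnn _))).
  exact: leq_trans (leq_card_footprint hC N BA) (As N).
rewrite /counting; case: asboolP => [fA|iA]; split => [|As].
- rewrite lee_fin ler_nat => As n; apply: leq_trans As.
  by rewrite -{1}(fset_setK fA) card_footprint_fset.
- by rewrite lee_fin ler_nat; apply: fsetP => //; rewrite fset_setK.
- by rewrite leye_eq.
- have [B BA] := infinite_set_fset s.+1 iA.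
  by rewrite ltnNge fsetP.
Qed.

Lemma counting_footprint (A : set X) :
  counting A = ereal_sup (range (fun n => (#|footprint n A|%:R : R)%:E)).
Proof.
apply/eqP; rewrite eq_le; apply/andP; split; last first.
  apply: ge_ereal_sup => _ [n _ <-].
  rewrite /counting; case: asboolP => [fA|_]; last by rewrite leey.
  by rewrite lee_fin ler_nat -{1}(fset_setK fA) card_footprint_fset.
set s := ereal_sup _.
have us n : ((#|footprint n A|%:R : R)%:E <= s)%E.
  by apply: ereal_sup_ubound; exists n.
case: s us => [r| |] us; last 2 first.
- by rewrite leey.
- by have := us 0%N.
have r0 : 0 <= r by have := us 0%N; rewrite lee_fin; exact: le_trans.
apply: (@le_trans _ _ (Num.trunc r)%:R%:E); last by rewrite lee_fin truncn_le.
apply/counting_le_natP => n; have := us n; rewrite lee_fin.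
by rewrite truncn_ge_nat.
Qed.

(** At a given level, the number of cells met by [A `&` U] is a finite sum of
indicators of open sets of the hyperspace; the supremum over the levels is then
measurable. *)
Lemma measurable_counting (U : set X) : open U ->
  measurable_fun [set: borel (cpt X)]
    (fun A => counting (sval A `&` U) : \bar R).
Proof.
move=> oU; pose f n (A : borel (cpt X)) : \bar R :=
  (#|footprint n (sval A `&` U)|%:R : R)%:E.
rewrite (_ : (fun _ => _) = (fun A => esups (f ^~ A) 0%N)); last first.
  apply/funext => A; rewrite counting_footprint /esups /=; congr ereal_sup.
  by apply/seteqP; split => _ [n _ <-]; exists n.
apply: measurable_fun_esups => n; apply/measurable_EFinP.
rewrite (_ : (fun _ => _) =
    (fun A => \sum_(c : C n) \1_(hits (cylinder hC [set c]%SET `&` U)) A)).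
  apply: measurable_sum => c; apply: measurable_indic; apply: measurable_hits.
  by apply: openI => //; exact: open_cylinder.
apply/funext => A; rewrite -sum1_card natr_sum big_mkcond /=.
apply: eq_bigr => c _; rewrite indicE.
case: ifPn => [/footprintP[x [Ax Ux] xc]|cA].
  rewrite mem_set//; exists x; split => //; split => //.
  by rewrite /cylinder /= xc finset.inE.
rewrite memNset// => -[x [Ax [/= xc Ux]]].
move/negP : cA; apply; apply/footprintP; exists x => //.
by move: xc; rewrite /cylinder /= finset.inE => /eqP.
Qed.

(** A finite metric space is discrete, hence not perfect. *)
Lemma infinite_cantor : perfect_set [set: X] -> infinite_set [set: X].
Proof.
move=> /perfectTP pX fX; apply: (pX point).
rewrite -[X in open X]setCK; apply: closed_openC.
apply: (accessible_finite_set_closed.1 _) => //; last exact: sub_finite_set fX.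
by apply: hausdorff_accessible; exact: (@metric_hausdorff _ X).
Qed.

End counting_cells.

(** * Generation of the Borel sigma-algebra of the hyperspace *)

Section generation.
Context (R : realType) (X : pmetricType R) (cX : compact [set: X]).
Context (C : nat -> {fset set X}) (hC : tree_structure C).
Local Notation footprint := (footprint hC).

Definition level n (S : {set C n}) : set (cpt X) :=
  [set A | footprint n (sval A) = S].

(** Meeting exactly the cells of [S] means being inside their union, but not inside
the union of the cells of [S] other than [c], for any [c] in [S]. In this form
the event involves only sets [inside U] with [U] clopen. *)
Lemma levelE n (S : {set C n}) : level S = inside (cylinder hC S) `&`
  \bigcap_(c in [set` S]) ~` inside (cylinder hC (S :\ c)%SET).
Proof.
apply/seteqP; split => [A AS|A [/asboolP AS AnS]].
  split; first by apply/asboolP; rewrite -footprint_subset AS.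
  move=> c /= cS /asboolP; rewrite -footprint_subset AS => /fintype.subsetP/(_ c cS).
  by rewrite !finset.inE eqxx.
apply/eqP; rewrite finset.eqEsubset footprint_subset AS /=.
apply/fintype.subsetP => c cS; apply/negPn/negP => cA.
apply: (AnS c cS); apply/asboolP; rewrite -footprint_subset.
apply/fintype.subsetP => d dA; rewrite !finset.inE; apply/andP; split.
  by apply: contraNneq cA => <-.
by move: dA; apply/fintype.subsetP; rewrite footprint_subset.
Qed.

(** Two compact sets with the same footprint are at Hausdorff distance at most the
largest diameter of a cell. *)
Lemma level_nbhs (O : set (cpt X)) A : open O -> O A ->
  exists n, level (footprint n (sval A)) `<=` O.
Proof.
move=> oO OA; have /nbhs_ballP[e /= e0 eO] : nbhs A O by apply: open_nbhs_nbhs.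
have e20 : 0 < e / 2 by rewrite divr_gt0.
have [N HN] := cell_fine cX hC e20; exists N => B AB.
apply: eO; rewrite ballEmdist /=; apply: (@le_lt_trans _ _ (e / 2)); last first.
  by rewrite ltr_pdivrMr// ltr_pMr// ltr1n.
apply: hausdorff_dist_le; split => // x.
  move=> /(mem_footprint hC N); rewrite -AB => /footprintP[y By /HN yx].
  by exists y => //; rewrite ballEmdist; exact: yx.
move=> /(mem_footprint hC N); rewrite AB => /footprintP[y Ay /HN yx].
by exists y => //; rewrite ballEmdist; exact: yx.
Qed.

Definition clopen_insides : set (set (cpt X)) := [set inside U | U in clopen].

Lemma setI_closed_clopen_insides : setI_closed clopen_insides.
Proof.
move=> _ _ [U cU <-] [V cV <-]; exists (U `&` V); last by rewrite insideI.
exact: clopenI.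
Qed.

(** By [level_nbhs], an open set is the union, over all the levels, of the finitely
many sets [level S] that it contains. *)
Lemma measurable_clopen_insides :
  @measurable _ (borel (cpt X)) = <<s clopen_insides >>.
Proof.
apply/seteqP; split; apply: smallest_sub; try exact: smallest_sigma_algebra.
  move=> O oO.
  have mi (U : set X) : clopen U ->
      measurable (inside U : set (g_sigma_algebraType clopen_insides)).
    by move=> cU; apply: sub_sigma_algebra; exists U.
  rewrite (_ : O = \bigcup_n
      \bigcup_(S in [set S : {set C n} | level S `<=` O]) level S).
    apply: (@bigcup_measurable _ (g_sigma_algebraType clopen_insides)) => n _.
    apply: fin_bigcup_measurable => // S _; rewrite levelE.
    apply: measurableI; first by apply: mi; exact: clopen_cylinder.
    apply: fin_bigcap_measurable => // c _; apply: measurableC.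
    by apply: mi; exact: clopen_cylinder.
  apply/seteqP; split => [A /(level_nbhs oO)[n nO]|A [n _ [S SO]]]; last exact: SO.
  by exists n => //; exists (footprint n (sval A)).
by move=> _ [U [oU _] <-]; exact: measurable_inside.
Qed.

Lemma measurable_level n (S : {set C n}) :
  measurable (level S : set (borel (cpt X))).
Proof.
rewrite levelE; apply: measurableI.
  by apply: measurable_inside; exact: open_cylinder.
apply: fin_bigcap_measurable => // c _; apply: measurableC.
by apply: measurable_inside; exact: open_cylinder.
Qed.

End generation.

(** * Exchangeable weights on the subsets of a finite set *)

Section exchangeable.
Context (R : realFieldType) (T : finType) (p : {set T} -> R).
Hypothesis exch : forall S S' : {set T}, #|S| = #|S'| -> p S = p S'.

(** All the sets of size [r] have the same weight, so the two sums are proportional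
to the numbers of their terms. *)
Lemma exchangeable_subset (V : {set T}) r :
  \sum_(S : {set T} | (S \subset V) && (#|S| == r)) p S =
  'C(#|V|, r)%:R / 'C(#|T|, r)%:R * \sum_(S : {set T} | #|S| == r) p S.
Proof.
have [rT|Tr] := leqP r #|T|; last first.
  have no (S : {set T}) : (#|S| == r) = false.
    by apply/negbTE; rewrite neq_ltn (leq_ltn_trans (max_card _) Tr).
  by rewrite [LHS]big1 ?[in RHS]big1 ?mulr0// => S; rewrite no// andbF.
have [S0 S0r] : exists S0 : {set T}, #|S0| = r.
  exists [set x in take r (enum T)]%SET.
  rewrite cardsE (card_uniqP _) ?take_uniq ?enum_uniq// size_take -cardE.
  by case: ltngtP rT.
have sumE (P : pred {set T}) : \sum_(S : {set T} | P S && (#|S| == r)) p S =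
    #|[set S | P S && (#|S| == r)]%SET|%:R * p S0.
  rewrite (eq_bigr (fun=> p S0)); last first.
    by move=> S /andP[_ /eqP Sr]; apply: exch; rewrite Sr.
  rewrite sumr_const mulr_natl; congr (_ *+ _).
  by apply: eq_card => S; rewrite finset.inE.
rewrite sumE cards_draws (sumE predT) /=.
rewrite card_draws mulrA divfK// pnatr_eq0 -lt0n bin_gt0//.
Qed.

End exchangeable.

(** The ratio is the product of the [(t - j) / (k - j)] for [j < r], none of which
exceeds [t / k]. *)
Lemma bin_ratio_le (R : realFieldType) (t k r : nat) : (t <= k)%N ->
  'C(t, r)%:R / 'C(k, r)%:R <= (t%:R / k%:R : R) ^+ r.
Proof.
move=> tk; have [rk|kr] := leqP r k; last first.
  by rewrite bin_small ?(leq_ltn_trans tk)// mul0r exprn_ge0// divr_ge0.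
case: k tk rk => [|k] tk rk.
  by move: rk; rewrite leqn0 => /eqP ->; rewrite !bin0 expr0 divff.
have k0 : 0 < k.+1%:R :> R by rewrite ltr0n.
rewrite expr_div_n ler_pdivrMr ?ltr0n ?bin_gt0// mulrAC ler_pdivlMr ?exprn_gt0//.
rewrite -!natrX -!natrM ler_nat.
suff : (t ^_ r * k.+1 ^ r <= k.+1 ^_ r * t ^ r)%N.
  by rewrite -!bin_ffact mulnAC [leqRHS]mulnAC leq_pmul2r ?fact_gt0// [leqRHS]mulnC.
elim: r {rk} => [|r IH]; first by rewrite !expn0.
rewrite !ffactnSr !expnSr mulnACA [leqRHS]mulnACA leq_mul//.
by rewrite !mulnBl [(k.+1 * t)%N]mulnC leq_sub2l// leq_mul2l tk orbT.
Qed.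

(** A random set with exchangeable weights lies within [V] and has at least [s]
elements with probability at most the [s]-th power of the proportion of [V]:
conditionally on its size [r], the probability of lying within [V] is a ratio of
binomial coefficients. *)
Lemma exchangeable_tail (R : realFieldType) (T : finType) (p : {set T} -> R)
    (V : {set T}) s : (forall S, 0 <= p S) ->
  (forall S S' : {set T}, #|S| = #|S'| -> p S = p S') ->
  \sum_(S : {set T} | (S \subset V) && (s <= #|S|)%N) p S <=
  (#|V|%:R / #|T|%:R) ^+ s * \sum_S p S.
Proof.
move=> p0 exch; have cS (S : {set T}) : (#|S| < #|T|.+1)%N by rewrite ltnS max_card.
rewrite (partition_big (fun S => Ordinal (cS S)) predT)//=.
rewrite [in leRHS](partition_big (fun S => Ordinal (cS S)) predT)//= mulr_sumr.
apply: ler_sum => -[r /= rT] _.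
have [sr|rs] := leqP s r; last first.
  rewrite big1 ?mulr_ge0 ?exprn_ge0 ?divr_ge0 ?sumr_ge0// => S /andP[/andP[_ sS]].
  by rewrite -val_eqE /= => /eqP Sr; move: sS; rewrite Sr leqNgt rs.
rewrite (eq_bigl (fun S : {set T} => (S \subset V) && (#|S| == r))); last first.
  move=> S; rewrite -val_eqE /=; case: eqP => [->|]; rewrite ?andbF//.
  by rewrite sr !andbT.
rewrite exchangeable_subset// [in leRHS](eq_bigl (fun S : {set T} => #|S| == r)); last first.
  by move=> S; rewrite -val_eqE.
apply: ler_wpM2r; first by rewrite sumr_ge0.
apply: le_trans (bin_ratio_le _ _ (max_card _)) _.
have VT1 : #|V|%:R / #|T|%:R <= 1 :> R.
  have [T0|T0] := posnP #|T|; first by rewrite T0 invr0 mulr0.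
  by rewrite ler_pdivrMr ?ltr0n// mul1r ler_nat max_card.
by apply: ler_wiXn2l; rewrite ?divr_ge0.
Qed.

(** * Laws of the footprints of an invariant measure *)

Section level_laws.
Context (R : realType) (X : pmetricType R) (cX : compact [set: X]).
Context (C : nat -> {fset set X}) (hC : tree_structure C).
Context (m : {measure set (borel (cpt X)) -> \bar R}).
Hypothesis mfin : (m setT < +oo)%E.
Local Notation footprint := (footprint hC).

Lemma finite_measure_fin_num (B : set (borel (cpt X))) :
  measurable B -> m B \is a fin_num.
Proof.
move=> mB; rewrite ge0_fin_numE//; apply: le_lt_trans mfin.
by apply: le_measure; rewrite ?inE//; exact: subsetT.
Qed.

Definition level_mass n (S : {set C n}) : R := fine (m (level hC S)).

Lemma level_mass_ge0 n (S : {set C n}) : 0 <= level_mass S.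
Proof. by rewrite /level_mass fine_ge0. Qed.

Definition levels n (P : pred {set C n}) : set (borel (cpt X)) :=
  [set A | P (footprint n (sval A))].

Lemma levels_bigcup n (P : pred {set C n}) :
  levels P = \bigcup_(S in [set` P]) level hC S.
Proof.
apply/seteqP; split => [A PA|A [S PS AS]]; last by rewrite /levels /= AS.
by exists (footprint n (sval A)).
Qed.

Lemma measurable_levels n (P : pred {set C n}) : measurable (levels P).
Proof.
rewrite levels_bigcup; apply: fin_bigcup_measurable => // S _.
exact: measurable_level.
Qed.

Lemma measure_levels n (P : pred {set C n}) :
  m (levels P) = (\sum_(S : {set C n} | P S) level_mass S)%:E.
Proof.
rewrite levels_bigcup measure_fin_bigcup//; last 2 first.
- by move=> S T _ _ [A [<- <-]].
- by move=> S _; exact: measurable_level.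
rewrite (_ : [set` P] = [set S | S \in [seq S <- index_enum _ | P S]]); last first.
  by apply/seteqP; split => S /=; rewrite mem_filter mem_index_enum andbT.
rewrite -fsbig_seq ?filter_uniq ?index_enum_uniq// big_filter -sumEFin.
apply: eq_bigr => S _; rewrite fineK//.
by apply: finite_measure_fin_num; exact: measurable_level.
Qed.


Definition sparse n s : set (borel (cpt X)) :=
  levels (fun S : {set C n} => (#|S| <= s)%N).

Definition few (s : nat) : set (borel (cpt X)) :=
  [set A | (counting (sval A) <= (s%:R : R)%:E)%E].

Lemma few_bigcap s : few s = \bigcap_n sparse n s.
Proof.
apply/seteqP; split => A; first by move=> /(counting_le_natP cX hC) As n _; exact: As.
by move=> As; apply/(counting_le_natP cX hC) => n; exact: As.
Qed.

Lemma measurable_few s : measurable (few s).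
Proof.
by rewrite few_bigcap; apply: bigcapT_measurable => n; exact: measurable_levels.
Qed.

(** The number of cells met grows with the level and reaches the cardinality in the
limit, so these events decrease to [few s]. *)
Lemma sparse_cvg s : m (sparse n s) @[n --> \oo] --> m (few s).
Proof.
rewrite few_bigcap; apply: nonincreasing_cvg_mu.
- apply: le_lt_trans mfin; apply: le_measure; rewrite ?inE//; exact: measurable_levels.
- by move=> n; exact: measurable_levels.
- by rewrite -few_bigcap; exact: measurable_few.
- move=> i j ij; apply/subsetPset => A; apply: leq_trans.
  exact: card_footprint_le.
Qed.

Lemma cells_gt0 n : (0 < #|{: C n}|)%N.
Proof. by apply/card_gt0P; exists (cell hC n point). Qed.

(** The descendants of [c] at level [n] are the cells of level [n] contained in [c],
and [z] is one minus the infimum of their proportions. *)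
Lemma cell_density k (c : C k) : exists2 z : R, 0 <= z < 1 &
  forall n, (k <= n)%N -> exists2 V : {set C n}, ~` val c = cylinder hC V &
    #|V|%:R / #|{: C n}|%:R <= z.
Proof.
have [_ _ _ /(_ k (val c) (fsvalP c))] := hC; set d := inf _ => d0.
have dn n : (k <= n)%N -> exists2 V : {set C n}, ~` val c = cylinder hC V &
    #|V|%:R / #|{: C n}|%:R <= 1 - d.
  move=> kn; pose W := [set e : C n | `[< val e `<=` val c >]]%SET.
  exists (~: W)%SET.
    rewrite -cylinderC; congr (~` _); apply/seteqP; split => x.
      rewrite valE /cylinder /= finset.inE => xc; apply/asboolP => y.
      by rewrite !valE /= -xc; exact: cell_refine.
    rewrite /cylinder /= finset.inE => /asboolP; apply; exact: cellP.
  have dW : d <= #|W|%:R / #|{: C n}|%:R.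
    have -> : #|W|%:R / #|{: C n}|%:R = descendant_ratio C (val c) n.
      rewrite /descendant_ratio -cardfE; congr (_%:R / _).
      rewrite (_ : [fset D in C n | `[< (D `<=` val c)%classic >]]%fset =
          [fset val e | e in W]%fset).
        by rewrite card_imfset ?cardE//; exact: val_inj.
      apply/fsetP => D; rewrite !inE /=; apply/andP/imfsetP => [[DC Dc]|[e /= eW ->]].
        by exists [` DC]%fset => //=; rewrite finset.inE.
      by split; [exact: fsvalP|move: eW; rewrite finset.inE].
    apply: ge_inf; last by exists n.
    by exists 0 => _ [i _ <-]; rewrite divr_ge0.
  rewrite lerBrDr -lerBrDl; apply: (le_trans dW).
  rewrite lerBrDl -mulrDl -natrD addnC cardsC divff// pnatr_eq0 -lt0n.
  exact: cells_gt0.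
exists (1 - d) => //; rewrite ltrBlDr ltrDl d0 andbT.
by have [V _] := dn k (leqnn _); apply: le_trans; rewrite divr_ge0.
Qed.

Context (G : groupType) (a : action G X) (ha : deeply_transitive_wrt a C).
Hypothesis minv : forall g (B : set (borel (cpt X))), measurable B ->
  m (hyper_action a g @^-1` B) = m B.

Lemma level_mass_exchangeable n (S T : {set C n}) : #|S| = #|T| ->
  level_mass S = level_mass T.
Proof.
have [S0|S0] := posnP #|S|.
  by move=> ST; have /eqP := S0; rewrite cards_eq0 => /eqP ->; rewrite S0 in ST;
    have /eqP := esym ST; rewrite cards_eq0 => /eqP ->.
move=> ST; have [g gST] := footprint_transitive hC ha ST S0.
rewrite /level_mass -(minv g (measurable_level hC T)); congr (fine (m _)).
by apply/seteqP; split => A /gST.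
Qed.

(** Missing [c] means lying within the cells outside [c], whose proportion is at
most [z < 1]. At a given level this has probability at most [z ^+ s] on the
sets that meet at least [s] cells, while meeting at most [s] cells becomes
negligible when the level grows. It remains to let [s] tend to infinity. *)
Lemma missing_cell_null k (c : C k) : (forall s, m (few s) = 0%E) ->
  m (inside (~` val c)) = 0%E.
Proof.
move=> m0; have [z /andP[z0 z1] zP] := cell_density c.
have minside : measurable (inside (~` val c) : set (borel (cpt X))).
  by have [V -> _] := zP k (leqnn _); apply: measurable_inside; exact: open_cylinder.
have H s : (m (inside (~` val c)) <= (z ^+ s * fine (m setT))%:E)%E.
  apply/lee_addgt0Pr => e e0.
  have : \forall n \near \oo, (m (sparse n s) < e%:E)%E.
    have sc := @sparse_cvg s; rewrite m0 in sc.
    by apply: (sc [set x | (x < e%:E)%E]); apply: open_ereal_lt'; rewrite lte_fin.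
  move=> -[N _ HN]; pose n := maxn N k.
  have [V cV Vz] := zP n (leq_maxr _ _).
  pose P (S : {set C n}) := (S \subset V) && (s <= #|S|)%N.
  have sub : inside (~` val c) `<=` levels P `|` sparse n s.
    move=> A; rewrite cV => AV.
    have AV' : footprint n (sval A) \subset V by rewrite footprint_subset; exact/asboolP.
    have [sA|As] := leqP s #|footprint n (sval A)|.
      by left; rewrite /levels /P /= AV' sA.
    by right; exact: ltnW.
  apply: (@le_trans _ _ (m (levels P `|` sparse n s))).
    apply: le_measure; rewrite ?inE//.
    by apply: measurableU; exact: measurable_levels.
  apply: (@le_trans _ _ (m (levels P) + m (sparse n s))%E).
    by apply: measureU2; exact: measurable_levels.
  apply: leeD; last by apply/ltW; apply: HN; exact: leq_maxl.
  rewrite measure_levels lee_fin.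
  apply: le_trans (exchangeable_tail _ _ _ _) _ => //.
  - exact: level_mass_ge0.
  - exact: level_mass_exchangeable.
  have -> : \sum_(S : {set C n}) level_mass S = fine (m setT).
    rewrite -[LHS]/(fine (\sum_(S : {set C n} | predT S) level_mass S)%:E) -measure_levels.
    by congr (fine (m _)); apply/seteqP.
  by apply: ler_wpM2r; [rewrite fine_ge0|rewrite lerXn2r ?nnegrE ?divr_ge0].
apply/eqP; rewrite eq_le measure_ge0 andbT.
rewrite -[m _]fineK ?finite_measure_fin_num// lee_fin.
have zM : geometric (fine (m setT)) z @ \oo --> (0 : R).
  by apply: cvg_geometric; rewrite ger0_norm.
rewrite -(cvg_lim _ zM)//; apply: limr_ge; first by apply/cvg_ex; exists 0.
near=> s; have := H s; rewrite -[m _]fineK ?finite_measure_fin_num// lee_fin.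
by rewrite /geometric /= mulrC.
Unshelve. all: by end_near.
Qed.

End level_laws.

(** * Uniqueness on the sets with a given number of points *)

Lemma hyperspace_measure_unique (R : realType) (X : pmetricType R)
    (cX : compact [set: X]) (C : nat -> {fset set X}) (hC : tree_structure C)
    (m1 m2 : {measure set (borel (cpt X)) -> \bar R}) :
  (m1 setT < +oo)%E ->
  (forall U : set X, clopen U -> m1 (inside U) = m2 (inside U)) ->
  forall B, measurable B -> m1 B = m2 B.
Proof.
move=> m1fin m12 B mB.
apply: (@measure_unique _ R (borel (cpt X)) (@clopen_insides R X) (fun=> setT)) => //.
- exact: measurable_clopen_insides cX _ hC.
- exact: setI_closed_clopen_insides.
- by move=> _; exists setT; [exact: clopenT|apply/seteqP].
- by rewrite bigcup_const.
- by move=> _ [U cU <-]; exact: m12.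
Qed.

Section uniqueness.
Context (R : realType) (X : pmetricType R) (cX : compact [set: X]).
Context (C : nat -> {fset set X}) (hC : tree_structure C).
Context (G : groupType) (a : action G X) (ha : deeply_transitive_wrt a C).

Section one_measure.
Context (m : {measure set (borel (cpt X)) -> \bar R}).
Hypothesis mfin : (m setT < +oo)%E.
Hypothesis minv : forall g (B : set (borel (cpt X))), measurable B ->
  m (hyper_action a g @^-1` B) = m B.
Local Notation p := (level_mass hC m).

(** The sets that meet exactly [r.+1] cells contribute to the mass of
[inside (cylinder hC V)] in the proportion given by the uniform law. The
remaining mass, both there and in [m setT], comes from the sets that meet at
most [r] cells, since meeting more than [r.+1] cells requires more than [r.+1]
points. *)
Lemma inside_mass_approx n (V : {set C n}) r :
  m (~` few r.+1) = 0%E ->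
  `|fine (m (inside (cylinder hC V))) -
    'C(#|V|, r.+1)%:R / 'C(#|{: C n}|, r.+1)%:R * fine (m setT)| <=
  fine (m (sparse hC n r)).
Proof.
move=> m0; have p0 := @level_mass_ge0 _ _ _ hC m n.
have big0 (S : {set C n}) : (r.+1 < #|S|)%N -> p S = 0.
  move=> rS; rewrite /level_mass (_ : m _ = 0%E)//; apply/eqP.
  rewrite eq_le measure_ge0 andbT -m0; apply: le_measure; rewrite ?inE.
  - exact: measurable_level.
  - by apply: measurableC; exact: (measurable_few cX hC).
  - by move=> A AS /(counting_le_natP cX hC)/(_ n); rewrite AS leqNgt rS.
have split3 (P : pred {set C n}) : \sum_(S : {set C n} | P S) p S =
    \sum_(S : {set C n} | P S && (#|S| <= r)%N) p S +
    \sum_(S : {set C n} | P S && (#|S| == r.+1)) p S.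
  rewrite (bigID (fun S : {set C n} => (#|S| <= r)%N)) /=; congr (_ + _).
  rewrite (bigID (fun S : {set C n} => #|S| == r.+1)) /= [X in _ + X]big1 ?addr0.
    apply: eq_bigl => S; case: eqP => [->|]; rewrite ?andbF// -ltnNge ltnSn.
    by rewrite !andbT.
  move=> S /andP[/andP[_ rS] /eqP nS]; apply: big0.
  by rewrite ltn_neqAle eq_sym ltnNge rS andbT; exact/eqP.
have -> : m (inside (cylinder hC V)) = m (levels hC (fun S => S \subset V)).
  congr (m _); apply/seteqP; split => A; rewrite /levels /= footprint_subset.
    by move=> AV; exact/asboolP.
  by move=> /asboolP.
have -> : m setT = m (levels hC (fun S : {set C n} => true)).
  by congr (m _); apply/seteqP.
rewrite /sparse !measure_levels//= split3 (split3 predT) /=.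
rewrite exchangeable_subset; last exact: (level_mass_exchangeable hC ha minv).
rewrite [in leLHS](eq_bigl
    (fun S : {set C n} => (#|S| <= r)%N && (S \subset V))); last first.
  by move=> S; rewrite andbC.
set q := _ / _; set y := \sum_(_ | _ == _) _.
set e := \sum_(S : {set C n} | (#|S| <= r)%N) p S.
set f := \sum_(S | _ && _) _.
have -> : f + q * y - q * (e + y) = f - q * e by lra.
have f0 : 0 <= f by rewrite sumr_ge0.
have fe : f <= e.
  by rewrite /e (bigID (fun S : {set C n} => S \subset V)) /= lerDl sumr_ge0.
have q0 : 0 <= q by rewrite divr_ge0.
have q1 : q <= 1.
  apply: le_trans (bin_ratio_le R _ (max_card _)) _.
  rewrite exprn_ile1 ?divr_ge0// ler_pdivrMr ?mul1r ?ler_nat ?max_card//.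
  by rewrite ltr0n (cells_gt0 hC).
by rewrite ler_norml; apply/andP; split; nra.
Qed.

End one_measure.

(** In [inside_mass_approx], the approximating value depends only on the tree and on
the total mass, and the error tends to the mass of [few r], which vanishes for
both measures. *)
Lemma invariant_mass_unique (m1 m2 : {measure set (borel (cpt X)) -> \bar R}) r :
  (m1 setT < +oo)%E -> m1 setT = m2 setT ->
  (forall g (B : set (borel (cpt X))), measurable B ->
    m1 (hyper_action a g @^-1` B) = m1 B) ->
  (forall g (B : set (borel (cpt X))), measurable B ->
    m2 (hyper_action a g @^-1` B) = m2 B) ->
  m1 (~` few r.+1) = 0%E -> m1 (few r) = 0%E ->
  m2 (~` few r.+1) = 0%E -> m2 (few r) = 0%E ->
  forall B, measurable B -> m1 B = m2 B.
Proof.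
move=> m1fin m12 inv1 inv2 s1 t1 s2 t2.
have m2fin : (m2 setT < +oo)%E by rewrite -m12.
have H (U : set X) : clopen U -> m1 (inside U) = m2 (inside U).
  move=> cU; have [N HN] := clopen_cylinderP cX hC cU.
  have mU : measurable (inside U : set (borel (cpt X))).
    by apply: measurable_inside; case: cU.
  rewrite -(fineK (finite_measure_fin_num m1fin mU)).
  rewrite -(fineK (finite_measure_fin_num m2fin mU)); congr _%:E.
  apply/eqP; rewrite -subr_eq0 -normr_le0; apply/ler_addgt0Pl => e e0.
  rewrite addr0.
  have e20 : 0 < e / 2 by rewrite divr_gt0.
  have sc1 := @sparse_cvg _ _ cX _ hC m1 m1fin r; rewrite t1 in sc1.
  have sc2 := @sparse_cvg _ _ cX _ hC m2 m2fin r; rewrite t2 in sc2.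
  have e2nbhs := open_ereal_lt' (e20 : (0 < (e / 2)%:E)%E).
  have [N1 _ H1] := sc1 [set x | (x < (e / 2)%:E)%E] e2nbhs.
  have [N2 _ H2] := sc2 [set x | (x < (e / 2)%:E)%E] e2nbhs.
  pose n := maxn N (maxn N1 N2).
  have /H1 h1 : (N1 <= n)%N by rewrite /n !leq_max leqnn orbT.
  have /H2 h2 : (N2 <= n)%N by rewrite /n !leq_max leqnn !orbT.
  have A1 := inside_mass_approx m1fin inv1 (footprint hC n U) s1.
  have A2 := inside_mass_approx m2fin inv2 (footprint hC n U) s2.
  rewrite -HN ?leq_maxl// in A1; rewrite -HN ?leq_maxl// -m12 in A2.
  set q := _ / _ in A1; rewrite -/q in A2.
  have f1 : fine (m1 (sparse hC n r)) < e / 2.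
    by rewrite -lte_fin fineK// finite_measure_fin_num//; exact: measurable_levels.
  have f2 : fine (m2 (sparse hC n r)) < e / 2.
    by rewrite -lte_fin fineK// finite_measure_fin_num//; exact: measurable_levels.
  move: A1 A2; rewrite !ler_norml => /andP[? ?] /andP[? ?].
  by apply/andP; split; lra.
exact: (hyperspace_measure_unique cX hC).
Qed.

End uniqueness.

(** * Strata of the hyperspace *)

Section strata.
Context (R : realType) (X : pmetricType R) (hX : cantor_like X).
Let cX : compact [set: X] := let: And4 _ cX _ _ := hX in cX.
Context (C : nat -> {fset set X}) (hC : tree_structure C).
Context (G : groupType) (a : action G X).

Lemma counting_image_inj (f : X -> X) (A : set X) : injective f ->
  counting (f @` A) = counting A :> \bar R.
Proof.
move=> fi; have fE : finite_set (f @` A) = finite_set A.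
  by apply: eq_finite_set; apply: inj_card_eq => x y _ _; exact: fi.
rewrite /counting fE; case: asboolP => // fA.
by rewrite fset_set_image// card_imfset.
Qed.

(** The index 0 is free for the whole space because compact sets are nonempty, so
that the stratum [r.+1] consists of the sets with exactly [r.+1] points. *)
Definition stratum (i : nat) : set (borel (cpt X)) :=
  if i is r.+1 then few r.+1 `\` few r else [set whole_cpt hX].

Lemma few_act g s : hyper_action a g @^-1` few s = few s.
Proof.
apply/seteqP; split => A; rewrite /few /= counting_image_inj//; exact: act_inj.
Qed.

Lemma stratum_act g i : hyper_action a g @^-1` stratum i = stratum i.
Proof.
case: i => [|r] /=; last first.
  rewrite -[in RHS](few_act g r.+1) -[in RHS](few_act g r).
  by apply/seteqP; split.
have actT h : hyper_action a h (whole_cpt hX) = whole_cpt hX.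
  apply: cpt_eq; apply/seteqP; split => //= x _.
  by exists (a h^-1%g x) => //; rewrite -actM mulgV act1.
apply/seteqP; split => A /=; last by move=> ->; exact: actT.
by move=> /(congr1 (hyper_action a g^-1%g)); rewrite actT -actM mulVg act1.
Qed.

Lemma few0 : @few R X 0 = set0.
Proof.
apply/seteqP; split => // A /(counting_le_natP cX hC)/(_ 0%N).
have [_ [x Ax]] := svalP A.
rewrite leqn0 cards_eq0 => /eqP/setP/(_ (cell hC 0 x)).
by rewrite mem_footprint// finset.inE.
Qed.

Lemma few_mono s t : (s <= t)%N -> @few R X s `<=` few t.
Proof.
by move=> st A; rewrite /few /= => /le_trans; apply; rewrite lee_fin ler_nat.
Qed.

Lemma whole_not_few s : ~ few s (whole_cpt hX).
Proof.
rewrite /few /= /counting; case: asboolP => [fX _|_]; last by rewrite leye_eq.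
by have [pX _ _ _] := hX; exact: (infinite_cantor pX).
Qed.

Lemma finite_cptsE : @finite_cpts R X = \bigcup_s few s.
Proof.
apply/seteqP; split => A; rewrite /finite_cpts /few /=.
  move=> fA; exists #|` fset_set (sval A)| => //=.
  by rewrite /counting asboolT.
move=> [s _ /=]; rewrite /counting; case: asboolP => //.
Qed.

Lemma trivIset_stratum : trivIset setT stratum.
Proof.
apply/trivIsetP => i j _ _; wlog ij : i j / (i < j)%N.
  move=> H; rewrite neq_ltn => /orP[ij|ji]; first by apply: H => //; rewrite ltn_eqF.
  by rewrite setIC; apply: H => //; rewrite ltn_eqF.
move=> _; case: j ij => // j; rewrite ltnS => ij.
apply/seteqP; split => // A [Ai [Aj nAj]]; case: i ij Ai => [_ /= AX|i ij [Ai _]].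
  by move: Aj; rewrite AX; exact: whole_not_few.
by apply: nAj; exact: few_mono Ai.
Qed.

Lemma finite_cpts_strata : @finite_cpts R X = \bigcup_r stratum r.+1.
Proof.
rewrite finite_cptsE; apply/seteqP; split => A [s _].
  elim: s => [|s IH]; first by rewrite few0.
  by have [/IH//|nA As] := pselect (few s A); exists s.
by move=> -[As _]; exists s.+1.
Qed.

(** The complement of a proper compact subset is open and nonempty, hence contains
a cell. *)
Lemma not_wholeE : ~` [set whole_cpt hX] =
  \bigcup_n \bigcup_(c in [set: C n]) inside (~` val c).
Proof.
apply/seteqP; split => A.
  move=> AX; have [x nAx] : exists x, ~ sval A x.
    apply/existsNP => AT; apply: AX; apply: cpt_eq.
    by apply/seteqP; split => // x _; exact: AT.
  have oA : open (~` sval A).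
    apply: closed_openC; apply: compact_closed; last by case: (svalP A).
    exact: (@metric_hausdorff _ X).
  have /nbhs_ballP[e /= e0 eA] : nbhs x (~` sval A) by apply: open_nbhs_nbhs.
  have [N HN] := cell_fine cX hC e0.
  exists N => //; exists (cell hC N x) => // y Ay; rewrite (valE hC) => /esym yx.
  by apply: (eA y) => //; rewrite ballEmdist; exact: HN yx.
move=> [n _ [c _]] Ac AX; have [x xc] := cell_surj hC c.
apply: (Ac x); first by rewrite AX.
by rewrite (valE hC).
Qed.

Lemma measurable_inside_missing n (c : C n) :
  measurable (inside (~` val c) : set (borel (cpt X))).
Proof.
rewrite (_ : ~` _ = cylinder hC (~: [set c])%SET).
  by apply: measurable_inside; exact: open_cylinder.
apply/seteqP; split => x; rewrite /cylinder (valE hC) /= !finset.inE.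
  by move/eqP.
by move=> /eqP.
Qed.

Lemma measurable_whole : measurable ([set whole_cpt hX] : set (borel (cpt X))).
Proof.
rewrite -[X in measurable X]setCK not_wholeE; apply: measurableC.
apply: bigcup_measurable => n _; apply: fin_bigcup_measurable => // c _.
exact: measurable_inside_missing.
Qed.

Lemma measurable_stratum i : measurable (stratum i).
Proof.
case: i => [|r]; first exact: measurable_whole.
by apply: measurableD; exact: measurable_few cX _ hC _.
Qed.

Lemma measurable_finite_cpts :
  measurable (@finite_cpts R X : set (borel (cpt X))).
Proof.
rewrite finite_cptsE; apply: bigcupT_measurable => s.
exact: measurable_few cX _ hC _.
Qed.

Context (ha : deeply_transitive_wrt a C).

Lemma nonfinitary_not_whole (m : {measure set (borel (cpt X)) -> \bar R}) :
  (m setT < +oo)%E ->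
  (forall g (B : set (borel (cpt X))), measurable B ->
    m (hyper_action a g @^-1` B) = m B) ->
  (forall s, m (few s) = 0%E) -> m (~` [set whole_cpt hX]) = 0%E.
Proof.
move=> mfin minv m0; apply/negligibleP.
  by apply: measurableC; exact: measurable_whole.
rewrite not_wholeE; apply: negligible_bigcup => n.
rewrite -bigsetU_fset_set; last exact: finite_finset.
apply: (@big_ind (set (borel (cpt X))) (fun A => m.-negligible A)).
- exact: negligible_set0.
- by move=> A B; exact: negligibleU.
move=> c _.
apply/negligibleP; first exact: measurable_inside_missing.
exact: (missing_cell_null cX hC mfin ha minv).
Qed.

End strata.

(** * Classification of the invariant random compacts *)

Section classification.
Context (R : realType) (X : pmetricType R) (hX : cantor_like X).
Let cX : compact [set: X] := let: And4 _ cX _ _ := hX in cX.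
Context (C : nat -> {fset set X}) (hC : tree_structure C).
Context (G : groupType) (a : action G X) (ha : deeply_transitive_wrt a C).
Implicit Types mu nu : probability (borel (cpt X)) R.
Local Notation stratum := (stratum hX).

Lemma mrestr_invariant mu (E : set (borel (cpt X))) (mE : measurable E) :
  IRC a mu ->
  (forall g, hyper_action a g @^-1` E = E) ->
  forall g (B : set (borel (cpt X))), measurable B ->
    mrestr mu mE (hyper_action a g @^-1` B) = mrestr mu mE B.
Proof.
move=> imu iE g B mB; rewrite /mrestr.
by rewrite -{1}(iE g) -preimage_setI imu//; exact: measurableI.
Qed.

Lemma mrestr_lty mu (E : set (borel (cpt X))) (mE : measurable E) :
  (mrestr mu mE setT < +oo)%E.
Proof. by rewrite /mrestr setTI (le_lt_trans (probability_le1 _ mE))// ltey. Qed.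

Lemma finite_cpts_act g :
  hyper_action a g @^-1` (@finite_cpts R X) = @finite_cpts R X.
Proof.
rewrite finite_cptsE preimage_bigcup; apply: eq_bigcupr => s _.
exact: few_act.
Qed.

(** The restriction of [mu] to the infinite compact sets is an invariant finite
measure that does not charge finite sets. *)
Lemma infinite_not_whole_null mu : IRC a mu ->
  mu (~` [set whole_cpt hX] `&` ~` @finite_cpts R X) = 0%E.
Proof.
move=> imu; have mF := measurable_finite_cpts hX hC.
have mFc := measurableC mF.
have := @nonfinitary_not_whole _ _ hX _ hC _ a ha (mrestr mu mFc).
apply.
- exact: mrestr_lty.
- apply: mrestr_invariant => // g.
  by rewrite -[in RHS](finite_cpts_act g).
- move=> s; rewrite /= /mrestr (_ : _ `&` _ = set0) ?measure0//.
  by apply/seteqP; split => // A [As]; apply; rewrite finite_cptsE; exists s.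
Qed.

Lemma IRC_eseries mu B : IRC a mu -> measurable B ->
  mu B = (\sum_(i <oo) mu (B `&` stratum i))%E.
Proof.
move=> imu mB; have mS := measurable_stratum hX hC.
rewrite -measure_semi_bigcup; last 3 first.
- by move=> i; exact: measurableI.
- exact/trivIset_setIl/trivIset_stratum.
- by apply: bigcupT_measurable => i; exact: measurableI.
rewrite -setI_bigcupr (measureDI mu mB (bigcupT_measurable _ mS)).
rewrite [X in (X + _)%E](_ : _ = 0%E) ?add0e//.
apply/eqP; rewrite eq_le measure_ge0 andbT -(infinite_not_whole_null imu).
have mU := bigcupT_measurable _ mS.
apply: le_measure; rewrite ?inE.
- exact: measurableD.
- apply: measurableI; apply: measurableC; first exact: measurable_whole hC.
  exact: measurable_finite_cpts hC.
- move=> A [_ nA]; split.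
    by move=> AX; apply: nA; exists 0%N.
  by rewrite (finite_cpts_strata hX hC) => -[r _ Ar]; apply: nA; exists r.+1.
Qed.

(** Stratum by stratum: [invariant_mass_unique] applies to the restrictions of [mu]
and [nu] to the sets with [r.+1] points. *)
Lemma IRC_unique mu nu : IRC a mu -> IRC a nu ->
  (forall i, mu (stratum i) = nu (stratum i)) -> mu ≡μ nu.
Proof.
move=> imu inu munu B mB; change (mu B = nu B).
rewrite (IRC_eseries imu mB) (IRC_eseries inu mB).
apply: eq_eseriesr => i _; have mS := measurable_stratum hX hC i.
case: i mS => [|r] mS.
  have [XB|nXB] := pselect (B (whole_cpt hX)).
    rewrite (_ : B `&` _ = stratum 0%N) ?munu//.
    by apply/seteqP; split => A [] // ->.
  rewrite (_ : B `&` _ = set0) ?measure0//.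
  by apply/seteqP; split => // A [BA /= AX]; apply: nXB; rewrite -AX.
have := @invariant_mass_unique _ _ cX _ hC _ a ha (mrestr mu mS) (mrestr nu mS) r.
apply => //.
- exact: mrestr_lty.
- by rewrite /= /mrestr !setTI; exact: (munu r.+1).
- by apply: mrestr_invariant => // g; exact: stratum_act.
- by apply: mrestr_invariant => // g; exact: stratum_act.
- rewrite /= /mrestr (_ : _ `&` _ = set0) ?measure0//.
  by apply/seteqP; split => // A [nA [/nA]].
- rewrite /= /mrestr (_ : _ `&` _ = set0) ?measure0//.
  by apply/seteqP; split => // A [Ar [_ /(_ Ar)]].
- rewrite /= /mrestr (_ : _ `&` _ = set0) ?measure0//.
  by apply/seteqP; split => // A [nA [/nA]].
- rewrite /= /mrestr (_ : _ `&` _ = set0) ?measure0//.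
  by apply/seteqP; split => // A [Ar [_ /(_ Ar)]].
Qed.

Lemma dirac_whole_IRC : IRC a (dirac_whole hX).
Proof.
move=> g B mB; have actX : hyper_action a g (whole_cpt hX) = whole_cpt hX.
  have : (hyper_action a g @^-1` stratum 0%N) (whole_cpt hX).
    by rewrite stratum_act.
  by [].
rewrite /dirac_whole /= !diracE; congr ((nat_of_bool _)%:R%:E).
have BX : B (hyper_action a g (whole_cpt hX)) = B (whole_cpt hX).
  by rewrite actX.
apply/idP/idP => /set_mem h; apply/mem_set; first by rewrite -BX.
by move: h; rewrite -BX.
Qed.

Lemma IRC_whole mu : mu (~` [set whole_cpt hX]) = 0%E -> mu ≡μ dirac_whole hX.
Proof.
move=> mu0 B mB; have mW := measurable_whole hX hC.
rewrite /dirac_whole /= diracE.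
have [XB|nXB] := pselect (B (whole_cpt hX)).
  rewrite mem_set// -[B]setCK probability_setC; last exact: measurableC.
  rewrite (_ : mu (~` B) = 0%E) ?sube0//; apply/eqP.
  rewrite eq_le measure_ge0 andbT -mu0; apply: le_measure; rewrite ?inE.
  - exact: measurableC.
  - exact: measurableC.
  - by move=> A nA /= AX; apply: nA; rewrite AX.
rewrite memNset//; transitivity (0%E : \bar R) => //; apply/eqP.
rewrite eq_le measure_ge0 andbT -mu0.
apply: le_measure; rewrite ?inE//; first exact: measurableC.
by move=> A BA /= AX; apply: nXB; rewrite -AX.
Qed.

Lemma borel_measurable_continuous (Y Z : ptopologicalType) (f : Y -> Z) :
  continuous f -> measurable_fun setT (f : borel Y -> borel Z).
Proof.
move=> /continuousP cf.
apply: (@measurability _ _ (borel Y) (borel Z) setT f (@open Z)) => //.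
by move=> _ [U oU <-]; rewrite setTI; apply: sub_sigma_algebra; exact: cf.
Qed.

Lemma IC_rigid_of_tree : IC_rigid hX a.
Proof.
have mF := measurable_finite_cpts hX hC.
move=> mu; split => [[imu nmu]|mud].
  apply: IRC_whole; apply: (@nonfinitary_not_whole _ _ hX _ hC _ a ha mu) => //.
    by apply: le_lt_trans (probability_le1 mu measurableT) _; rewrite ltey.
  move=> s; apply/eqP; rewrite eq_le measure_ge0 andbT -nmu.
  apply: le_measure; rewrite ?inE//; first exact: measurable_few cX _ hC _.
  by rewrite finite_cptsE => A As; exists s.
split.
  move=> g B mB; rewrite !mud//; first exact: dirac_whole_IRC.
  rewrite -[X in measurable X]setTI.
  by apply: borel_measurable_continuous => //; exact: act_continuous.
rewrite /nonfinitary mud// /dirac_whole /= diracE memNset//.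
by rewrite finite_cptsE => -[s _]; exact: whole_not_few.
Qed.

End classification.

(** * Mean number of points in a Borel set *)

Section counting_kernel.
Context (R : realType) (X : pmetricType R) (cX : compact [set: X]).
Context (C : nat -> {fset set X}) (hC : tree_structure C).

Lemma measurable_cpt (A : cpt X) : measurable (sval A : set (borel X)).
Proof.
rewrite -[sval A]setCK; apply: measurableC; apply: sub_sigma_algebra.
apply: closed_openC; apply: compact_closed; last by case: (svalP A).
exact: (@metric_hausdorff _ X).
Qed.

Lemma counting_setC (A : borel (cpt X)) (B : set (borel X)) s : measurable B ->
  few s A ->
  (counting (sval A `&` ~` B) =
   counting (sval A `&` setT) - counting (sval A `&` B) :> \bar R)%E.
Proof.
move=> mB As; have mA := measurable_cpt A.
have lt (D : set X) : D `<=` sval A -> (counting D : \bar R) \is a fin_num.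
  move=> DA; rewrite /counting; case: asboolP => // nD; exfalso; apply: nD.
  apply: (sub_finite_set DA).
  by have : @finite_cpts R X A by rewrite finite_cptsE; exists s.
rewrite setIT -setDE (@measureDI _ _ _ (@counting (borel X) R) _ _ mA mB).
by rewrite addeK// lt.
Qed.

(** Open sets form a pi-system for which this is [measurable_counting]. Passing to
the complement amounts to a difference of finite quantities, thanks to the
restriction to sets with at most [s] points. *)
Lemma measurable_counting_borel s (B : set (borel X)) : measurable B ->
  measurable_fun (few s)
    (fun A : borel (cpt X) => counting (sval A `&` B) : \bar R).
Proof.
move: B; apply: (@dynkin_induction _ (borel X) (@open X)) => //.
- by move=> U V; exact: openI.
- by apply: measurable_funTS; apply: (measurable_counting cX hC); exact: openT.
- by move=> U oU; apply: measurable_funTS; exact: measurable_counting cX _ hC _ oU.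
- move=> B mB mcB.
  apply: (@eq_measurable_fun _ _ _ _ _ (fun A : borel (cpt X) =>
    (counting (sval A `&` setT) - counting (sval A `&` B))%E : \bar R)).
    by move=> A /set_mem As; rewrite (counting_setC mB As).
  apply: emeasurable_funB => //.
  by apply: measurable_funTS; apply: (measurable_counting cX hC); exact: openT.
- move=> F mF tF mcF.
  apply: (@eq_measurable_fun _ _ _ _ _ (fun A : borel (cpt X) =>
    (\sum_(k <oo | k \in predT) counting (sval A `&` F k))%E : \bar R)).
    move=> A _; rewrite setI_bigcupr.
    rewrite (@measure_semi_bigcup _ _ _ (@counting (borel X) R))//.
    + by move=> i; apply: measurableI => //; exact: measurable_cpt.
    + exact: trivIset_setIl.
    + apply: bigcupT_measurable => i; apply: measurableI => //.
      exact: measurable_cpt.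
  apply: ge0_emeasurable_sum => // k A _ _.
  by rewrite (measure_ge0 (@counting (borel X) R)).
Qed.

End counting_kernel.

Section point_intensity.
Context (R : realType) (X : pmetricType R) (hX : cantor_like X).
Let cX : compact [set: X] := let: And4 _ cX _ _ := hX in cX.
Context (C : nat -> {fset set X}) (hC : tree_structure C).
Context (G : groupType) (a : action G X).
Variables (mu : probability (borel (cpt X)) R) (r : nat).
Local Notation E := (stratum hX r.+1).

Definition intensity (B : set (borel X)) : \bar R :=
  (\int[mu]_(A in E) counting (sval A `&` B))%E.

Lemma counting_ge0 (T : choiceType) (A : set T) : (0 <= counting A :> \bar R)%E.
Proof. by rewrite /counting; case: ifPn; rewrite ?lee_fin// leey. Qed.

Lemma measurable_counting_stratum (B : set (borel X)) : measurable B ->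
  measurable_fun E (fun A : borel (cpt X) => counting (sval A `&` B) : \bar R).
Proof.
move=> mB; apply: (@measurable_funS _ _ _ _ (few r.+1)).
- exact: measurable_few cX _ hC _.
- by move=> A [].
- exact: (measurable_counting_borel cX hC).
Qed.

Lemma intensity_sigma_additive : semi_sigma_additive intensity.
Proof.
move=> F mF tF mU.
have -> : intensity (\bigcup_n F n) = (\sum_(n <oo) intensity (F n))%E.
  rewrite /intensity -integral_nneseries//; first last.
  - by move=> n A _; exact: counting_ge0.
  - by move=> n; exact: measurable_counting_stratum.
  - exact: measurable_stratum hX _ hC _.
  apply: eq_integral => A _; rewrite setI_bigcupr.
  rewrite (@measure_semi_bigcup _ _ _ (@counting (borel X) R))//.
  + by move=> i; apply: measurableI => //; exact: measurable_cpt.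
  + exact: trivIset_setIl.
  + apply: bigcupT_measurable => i; apply: measurableI => //.
    exact: measurable_cpt.
apply: is_cvg_ereal_nneg_natsum => k _.
by apply: integral_ge0 => A _; exact: counting_ge0.
Qed.

Lemma counting_stratum (A : borel (cpt X)) : E A ->
  counting (sval A) = (r.+1%:R : R)%:E.
Proof.
move=> [/=]; rewrite /few /= /counting; case: asboolP => [fA|nA]; last first.
  by rewrite leye_eq.
rewrite !lee_fin !ler_nat => Ar /negP; rewrite -ltnNge => rA.
by congr (_%:R%:E); apply/eqP; rewrite eqn_leq Ar.
Qed.

Lemma intensityT : intensity setT = (r.+1%:R%:E * mu E)%E.
Proof.
rewrite -integral_cst; last exact: measurable_stratum hX _ hC _.
by apply: eq_integral => A /set_mem EA; rewrite setIT counting_stratum.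
Qed.

(** [A] has as many points in the preimage of [B] as its image has in [B], and the
image of [A] has the same law as [A]. *)
Lemma intensity_act g (B : set (borel X)) : IRC a mu -> measurable B ->
  intensity (a g @^-1` B) = intensity B.
Proof.
move=> imu mB; pose h : borel (cpt X) -> borel (cpt X) := hyper_action a g.
have mh : measurable_fun setT h.
  by apply: borel_measurable_continuous; exact: act_continuous.
pose hM := isMeasurableFun.Build _ _ _ _ _ mh.
pose hF : {mfun borel (cpt X) >-> borel (cpt X)} := HB.pack h hM.
have mE := measurable_stratum hX hC r.+1.
rewrite /intensity.
rewrite [RHS](@eq_measure_integral _ _ _ E (distribution mu hF) mu); last first.
  by move=> A mA _; exact: esym (imu g A mA).
rewrite [RHS]ge0_integral_pushforward//; first last.
- by move=> A _; exact: counting_ge0.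
- exact: measurable_counting_stratum.
rewrite [X in _ = (\int[mu]_(x in X) _)%E](stratum_act hX a g).
apply: eq_integral => A _ /=.
rewrite -(counting_image_inj _ (@act_inj _ _ _ a g)); congr counting.
apply/seteqP; split => [_ [x [Ax Bx] <-]|_ [[x Ax <-] Bx]].
  by split => //; exists x.
by exists x.
Qed.

(** [intensity] is invariant and its total mass, [r.+1] times the mass of the
stratum, is positive and finite; it can be normalized. *)
Lemma invariant_of_stratum : IRC a mu -> mu E != 0%E ->
  invariant_probabilities R a !=set0.
Proof.
move=> imu muE.
have i0 : intensity set0 = 0%E.
  rewrite /intensity integral0_eq// => A _.
  by rewrite setI0 /counting asboolT// fset_set0.
have ige0 B : (0 <= intensity B)%E.
  by apply: integral_ge0 => A _; exact: counting_ge0.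
pose iM := isMeasure.Build _ _ _ intensity i0 ige0 intensity_sigma_additive.
pose m : {measure set (borel X) -> \bar R} := HB.pack intensity iM.
exists (mnormalize m (\d_(point : borel X))).
move=> g B mB /=; rewrite /mnormalize.
have -> : m setT = intensity setT by [].
rewrite intensityT; case: ifPn => [|_]; last by rewrite /= intensity_act.
rewrite mule_eq0 (negbTE muE) orbF eqe pnatr_eq0 /=.
move=> /eqP muoo; exfalso.
have : (r.+1%:R%:E * mu E < +oo)%E.
  apply: lte_mul_pinfty; rewrite ?lee_fin//.
  apply: le_lt_trans (probability_le1 mu _) _; rewrite ?ltey//.
  exact: measurable_stratum hX _ hC _.
by rewrite muoo.
Qed.

End point_intensity.

(** * Sets of independent points *)

Section random_finite_sets.
Context (R : realType) (X : pmetricType R) (hX : cantor_like X).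
Let cX : compact [set: X] := let: And4 _ cX _ _ := hX in cX.
Context (C : nat -> {fset set X}) (hC : tree_structure C).
Context (G : groupType) (a : action G X) (ha : deeply_transitive_wrt a C).
Context (lambda : probability (borel X) R).
Hypothesis ilambda : invariant_probabilities R a lambda.

Lemma measurable_cylinder n (S : {set C n}) :
  measurable (cylinder hC S : set (borel X)).
Proof. by apply: sub_sigma_algebra; exact: open_cylinder. Qed.

(** Deep transitivity on single cells makes all the cells of a level equally likely. *)
Lemma invariant_cylinder n (S : {set C n}) :
  lambda (cylinder hC S) = (#|S|%:R / #|{: C n}|%:R)%:E.
Proof.
have mc (c : C n) : measurable (cylinder hC [set c]%SET : set (borel X)).
  exact: measurable_cylinder.
have eqc (c d : C n) :
    lambda (cylinder hC [set c]%SET) = lambda (cylinder hC [set d]%SET).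
  have [| |g gcd] :=
    @footprint_transitive _ _ _ hC _ a n [set c]%SET [set d]%SET ha.
  - by rewrite !cards1.
  - by rewrite cards1.
  rewrite -(ilambda g (mc d)); congr (lambda _).
  have fp1 x : footprint hC n [set x] = [set cell hC n x]%SET.
    apply/setP => e; rewrite finset.in_set1; apply/idP/idP => [|/eqP ->].
      by move=> /footprintP[y -> <-].
    exact: mem_footprint.
  apply/seteqP; split => x; rewrite /cylinder /= !finset.inE => /eqP xe.
    have := (gcd [set x]).2; rewrite image_set1 !fp1 xe => /(_ erefl)/setP/(_ d).
    by rewrite !finset.inE eqxx eq_sym.
  have := (gcd [set x]).1; rewrite image_set1 !fp1 xe => /(_ erefl)/setP/(_ c).
  by rewrite !finset.inE eqxx eq_sym.
pose v := fine (lambda (cylinder hC [set cell hC n point]%SET)).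
have cyl_sum (V : {set C n}) : lambda (cylinder hC V) = (#|V|%:R * v)%:E.
  rewrite (_ : cylinder hC V =
      \bigcup_(c in [set` V]) cylinder hC [set c]%SET); last first.
    apply/seteqP; split => x; rewrite /cylinder /=.
      by move=> xV; exists (cell hC n x) => //=; rewrite finset.inE.
    by move=> [c /= cV]; rewrite finset.inE => /eqP ->.
  rewrite measure_fin_bigcup//; last first.
    by move=> c d _ _ [x []]; rewrite /cylinder /= !finset.inE => /eqP <- /eqP.
  rewrite (_ : [set` V] = [set` enum V]); last first.
    by apply/seteqP; split => c /=; rewrite mem_enum.
  rewrite -fsbig_seq ?enum_uniq// (eq_bigr (fun=> v%:E)); last first.
    move=> c _; apply: etrans (eqc c (cell hC n point)) _.
    by rewrite /v fineK//; exact: fin_num_measure.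
  by rewrite big_enum sumEFin sumr_const mulr_natl.
have : lambda (cylinder hC [set: C n]%SET) = 1%E.
  rewrite (_ : cylinder _ _ = setT) ?probability_setT//.
  by apply/seteqP; split => // x _; rewrite /cylinder /= finset.inE.
rewrite !cyl_sum cardsT => -[kv].
have k0 : #|{: C n}|%:R != 0 :> R by rewrite pnatr_eq0 -lt0n (cells_gt0 hC).
by congr _%:E; rewrite -[v](mulKf k0) kv mulr1.
Qed.

Lemma cells_unbounded (N : nat) : exists n, (N < #|{: C n}|)%N.
Proof.
apply: contrapT => /forallNP kN.
have : (counting [set: X] <= (N%:R : R)%:E)%E.
  apply/(counting_le_natP cX hC) => n; rewrite footprintT cardsT leqNgt.
  exact/negP/kN.
rewrite /counting asboolF ?leye_eq//.
by have [pX _ _ _] := hX; exact: infinite_cantor.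
Qed.

Lemma cpt_add_subproof (A : cpt X) (x : X) :
  compact (sval A `|` [set x]) /\ sval A `|` [set x] !=set0.
Proof.
have [cA [y Ay]] := svalP A; split; last by exists y; left.
by apply: compactU => //; exact: compact_set1.
Qed.

Definition cpt_add (p : borel (cpt X) * borel X) : borel (cpt X) :=
  exist _ _ (cpt_add_subproof p.1 p.2).

Lemma measurable_hyperspace d (T : measurableType d) (f : T -> borel (cpt X)) :
  (forall U : set X, clopen U -> measurable (f @^-1` inside U)) ->
  measurable_fun setT f.
Proof.
move=> mf.
apply: (@measurability _ _ T (borel (cpt X)) setT f (@clopen_insides R X)).
  exact: measurable_clopen_insides cX _ hC.
by move=> _ [_ [U cU <-] <-]; rewrite setTI; exact: mf.
Qed.

Lemma cpt_add_inside (U : set X) : cpt_add @^-1` inside U = inside U `*` U.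
Proof.
apply/seteqP; split => -[A x]; rewrite /inside /=.
  by move=> AU; split => [y Ay|]; apply: AU; [left|right].
by move=> [AU Ux] y [/AU//|->].
Qed.

Lemma measurable_cpt_add : measurable_fun setT cpt_add.
Proof.
apply: measurable_hyperspace => U cU; rewrite cpt_add_inside.
apply: measurableX; last by apply: sub_sigma_algebra; case: cU.
by apply: measurable_inside; case: cU.
Qed.

Lemma measurable_cpt_set1 :
  measurable_fun setT (@cpt_set1 R X : borel X -> borel (cpt X)).
Proof.
apply: measurable_hyperspace => U cU.
rewrite (_ : _ @^-1` _ = U); first by apply: sub_sigma_algebra; case: cU.
apply/seteqP; split => x; rewrite /inside /=; first exact.
by move=> Ux y ->.
Qed.

Lemma few_cpt_add r (A : borel (cpt X)) x : few r A -> few r.+1 (cpt_add (A, x)).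
Proof.
rewrite /few /= /counting; case: asboolP => [fA|]; last by rewrite leye_eq.
case: asboolP => [fAx|]; last first.
  by move=> nf; exfalso; apply: nf; rewrite finite_setU; split.
rewrite !lee_fin !ler_nat => Ar.
rewrite fset_setU// fset_set1 fsetUC cardfsU1; case: (_ \notin _) => //.
by rewrite add0n; exact: leqW.
Qed.

(** The law of the set of [r.+1] independent points of law [lambda], built by adding
one independent point at a time. Such a set is inside [U] when all the points
fall in [U], hence the power; the sets [inside U] determine the law. The number
of points is only bounded here, as points may coincide. *)
Lemma sample_law_exists r : exists mu : probability (borel (cpt X)) R,
  (forall U : set X, clopen U -> mu (inside U) = (lambda U ^+ r.+1)%E) /\
  mu (few r.+1) = 1%E.
Proof.
have mfew s := @measurable_few _ _ cX _ hC s.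
elim: r => [|r [mu [mui mur]]].
  have M := isMeasurableFun.Build _ _ _ _ _ measurable_cpt_set1.
  pose h : {mfun borel X >-> borel (cpt X)} :=
    HB.pack (@cpt_set1 R X : borel X -> borel (cpt X)) M.
  exists (distribution lambda h); split => [U cU|].
    rewrite [RHS]/= /distribution /pushforward; congr (lambda _).
    by apply/seteqP; split => x; [exact|move=> Ux y ->].
  rewrite /= /distribution /pushforward.
  rewrite (_ : _ @^-1` _ = setT) ?probability_setT//.
  apply/seteqP; split => // x _; rewrite /few /= /counting asboolT//.
  by rewrite fset_set1 cardfs1.
have M := isMeasurableFun.Build _ _ _ _ _ measurable_cpt_add.
pose h : {mfun _ >-> _} := HB.pack cpt_add M.
pose P : probability _ R := (mu \x lambda)%E.
exists (distribution P h); split => [U cU|].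
  have oU : open U by case: cU.
  rewrite /= /distribution /pushforward [X in P X](cpt_add_inside U).
  transitivity (mu (inside U) * lambda U)%E; last by rewrite mui// muleC.
  apply: product_measure1E; first exact: measurable_inside.
  exact: sub_sigma_algebra.
apply/eqP; rewrite eq_le; apply/andP; split; first exact: probability_le1.
apply: (@le_trans _ _ (P (few r.+1 `*` setT))).
  suff -> : P (few r.+1 `*` setT) = (mu (few r.+1) * lambda setT)%E.
    by rewrite mur probability_setT mule1.
  by apply: product_measure1E => //; exact: mfew.
apply: le_measure; rewrite ?inE.
- exact: measurableX.
- by rewrite -[X in measurable X]setTI; exact: measurable_cpt_add.
- by move=> [A x] [/= Ar _]; exact: few_cpt_add.
Qed.

End random_finite_sets.

(** The two properties of [mu] are those provided by [sample_law_exists]. *)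
Section sample_laws.
Context (R : realType) (X : pmetricType R) (hX : cantor_like X).
Let cX : compact [set: X] := let: And4 _ cX _ _ := hX in cX.
Context (C : nat -> {fset set X}) (hC : tree_structure C).
Context (G : groupType) (a : action G X) (ha : deeply_transitive_wrt a C).
Context (lambda : probability (borel X) R).
Hypothesis ilambda : invariant_probabilities R a lambda.
Context (mu : probability (borel (cpt X)) R) (r : nat).
Hypothesis mui : forall U : set X, clopen U ->
  mu (inside U) = (lambda U ^+ r.+1)%E.
Hypothesis mur : mu (few r.+1) = 1%E.

Let mu_lty : ((mu : measure _ _) setT < +oo)%E.
Proof.
by apply: le_lt_trans (probability_le1 mu measurableT) _; rewrite ltey.
Qed.

(** The mass of [inside U] depends only on [lambda U], and the preimage of [inside U]
under the action is [inside] of the preimage of [U]. *)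
Lemma sample_law_IRC : IRC a mu.
Proof.
move=> g; pose h : borel (cpt X) -> borel (cpt X) := hyper_action a g.
have mh : measurable_fun setT h.
  by apply: borel_measurable_continuous; exact: act_continuous.
pose hM := isMeasurableFun.Build _ _ _ _ _ mh.
pose hF : {mfun borel (cpt X) >-> borel (cpt X)} := HB.pack h hM.
suff : forall B, measurable B -> distribution mu hF B = mu B by [].
apply: (hyperspace_measure_unique cX hC) => /=.
  apply: le_lt_trans (probability_le1 (distribution mu hF) measurableT) _.
  by rewrite ltey.
move=> U cU; rewrite /distribution /pushforward.
have ca : clopen (a g @^-1` U) by apply: clopen_comp => //; exact: act_continuous.
rewrite (_ : _ @^-1` _ = inside (a g @^-1` U)).
  rewrite !mui// ilambda//; apply: sub_sigma_algebra.
  by case: cU.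
apply/seteqP; split => A; rewrite /inside /=.
  by move=> AU x Ax; apply: AU; exists x.
by move=> AU _ [x Ax <-]; exact: AU.
Qed.

(** With [k] cells at a level, a set of at most [r] points lies in one of the unions
of [r] cells listed by the [k ^ r] functions [f]; each of these unions contains
the sample with probability at most [(r / k) ^+ r.+1]. The total is at most
[r ^+ r.+1 / k], and [k] is as large as desired. *)
Lemma sample_law_few : mu (few r) = 0%E.
Proof.
have mfew := @measurable_few _ _ cX _ hC r.
have finfew : mu (few r) \is a fin_num by exact: fin_num_measure.
pose p n := @level_mass _ _ _ hC mu n.
have inner n (V : {set C n}) : \sum_(S : {set C n} | S \subset V) p n S =
    (#|V|%:R / #|{: C n}|%:R) ^+ r.+1.
  apply: EFin_inj; rewrite -(measure_levels hC mu_lty).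
  rewrite EFin_expe -(invariant_cylinder hC ha ilambda) -mui; last first.
    exact: clopen_cylinder.
  congr (mu _); apply/seteqP; split => A; rewrite /levels /= footprint_subset.
    by move=> /asboolP.
  by move=> AV; exact/asboolP.
have bound n : fine (mu (few r)) <= r%:R ^+ r.+1 / #|{: C n}|%:R.
  have k0 := cells_gt0 hC n.
  have -> : r%:R ^+ r.+1 / #|{: C n}|%:R =
      \sum_(f : {ffun 'I_r -> C n}) (r%:R / #|{: C n}|%:R : R) ^+ r.+1.
    rewrite sumr_const card_ffun card_ord -[RHS]mulr_natr natrX expr_div_n.
    have kr0 : #|{: C n}|%:R ^+ r != 0 :> R.
      by rewrite expf_neq0// pnatr_eq0 -lt0n.
    by rewrite [#|_|%:R ^+ r.+1]exprS invfM mulrA divfK.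
  apply: (@le_trans _ _ (\sum_(S : {set C n} | (#|S| <= r)%N) p n S)).
    rewrite -lee_fin fineK// -(measure_levels hC mu_lty).
    apply: le_measure; rewrite ?inE//; first exact: measurable_levels.
    by move=> A /(counting_le_natP cX hC); exact.
  apply: (@le_trans _ _ (\sum_(f : {ffun 'I_r -> C n})
      \sum_(S : {set C n} | S \subset [set c in codom f]%SET) p n S)); last first.
    apply: ler_sum => f _; rewrite inner lerXn2r ?nnegrE ?divr_ge0//.
    rewrite ler_pM2r ?invr_gt0 ?ltr0n// ler_nat cardsE.
    by rewrite (leq_trans (card_size _))// size_codom card_ord.
  rewrite (exchange_big_dep predT)//= big_mkcond /=; apply: ler_sum => S _.
  have p0 : 0 <= p n S by exact: level_mass_ge0.
  case: ifPn => [Sr|_]; last exact: sumr_ge0.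
  (* f0 lists S, and repeats an arbitrary cell once S is exhausted *)
  pose f0 : {ffun 'I_r -> C n} :=
    [ffun i : 'I_r => nth (cell hC n point) (enum S) i].
  rewrite (bigD1 f0)/= ?lerDl ?sumr_ge0//.
  apply/fintype.subsetP => c cS; rewrite finset.inE; apply/codomP.
  have ir : (index c (enum S) < r)%N.
    by rewrite (leq_trans _ Sr)// cardE index_mem mem_enum.
  by exists (Ordinal ir); rewrite ffunE /= nth_index// mem_enum.
rewrite -(fineK finfew); congr _%:E; apply/eqP.
rewrite eq_le fine_ge0// andbT; apply/ler_addgt0Pl => e e0; rewrite addr0.
have [n kn] := cells_unbounded hX hC (Num.trunc (r%:R ^+ r.+1 / e)).
apply: le_trans (bound n) _.
rewrite ler_pdivrMr ?ltr0n ?(cells_gt0 hC)// -ler_pdivrMl//.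
rewrite mulrC; apply/ltW/(lt_le_trans (truncnS_gt _)).
by rewrite ler_nat.
Qed.

Lemma sample_law_stratum : mu (stratum hX r.+1) = 1%E.
Proof.
have mfew s := @measurable_few _ _ cX _ hC s.
have := measureDI mu (mfew r.+1) (mfew r).
rewrite (_ : few r.+1 `&` few r = few r); last first.
  apply/seteqP; split => A; first by case.
  by move=> Ar; split => //; exact: few_mono Ar.
by rewrite [X in (_ + X)%E]sample_law_few adde0 => <-.
Qed.

End sample_laws.

(** * The simplex of invariant random compacts *)

Section isomorphism.
Context (R : realType) (X : pmetricType R) (hX : cantor_like X).
Let cX : compact [set: X] := let: And4 _ cX _ _ := hX in cX.
Context (C : nat -> {fset set X}) (hC : tree_structure C).
Context (G : groupType) (a : action G X) (ha : deeply_transitive_wrt a C).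
Implicit Types mu nu : probability (borel (cpt X)) R.
Local Notation stratum := (stratum hX).

Definition stratum_mass mu i : R := fine (mu (stratum i)).

Lemma stratum_massK mu i : (stratum_mass mu i)%:E = mu (stratum i).
Proof.
rewrite /stratum_mass fineK//; apply: fin_num_measure.
exact: measurable_stratum hX _ hC _.
Qed.

Lemma stratum_mass_simplex mu : IRC a mu -> simplex R (stratum_mass mu).
Proof.
move=> imu; split=> [i|]; first by rewrite /stratum_mass fine_ge0.
have mS := measurable_stratum hX hC.
have tS := @trivIset_stratum _ _ hX.
have sa : semi_sigma_additive mu by exact: measure_semi_sigma_additive.
have := sa _ mS tS (bigcupT_measurable _ mS).
have -> : mu (\bigcup_n stratum n) = 1%E.
  rewrite -(@probability_setT _ _ _ mu) (IRC_eseries hX hC ha imu measurableT).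
  rewrite measure_semi_bigcup//; last exact: bigcupT_measurable.
  by apply: eq_eseriesr => i _; rewrite setTI.
move=> /fine_cvg; apply: cvg_trans; apply: near_eq_cvg; near=> n.
rewrite /= /series /=; apply: EFin_inj; rewrite -sumEFin.
rewrite fineK; first by apply: eq_bigr => i _; rewrite stratum_massK.
by apply/sum_fin_numP => i _ _; apply: fin_num_measure.
Unshelve. all: by end_near.
Qed.

Lemma stratum_mass_inj mu nu : IRC a mu -> IRC a nu ->
  stratum_mass mu = stratum_mass nu <-> mu ≡μ nu.
Proof.
move=> imu inu; split => [e|e].
  have H := IRC_unique (hX := hX) hC ha imu inu _; apply: H => i.
  by rewrite -!stratum_massK e.
apply/funext => i; congr fine; apply: e; exact: measurable_stratum hX _ hC _.
Qed.

Lemma stratum_mass_conv (t : {i01 R}) mu nu i :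
  stratum_mass (prob_conv t mu nu) i =
  t%:num * stratum_mass mu i + (1 - t%:num) * stratum_mass nu i.
Proof.
apply: EFin_inj; rewrite stratum_massK EFinD !EFinM !stratum_massK.
by [].
Qed.

Lemma extreme_IRC_exists (i : nat) : invariant_probabilities R a !=set0 ->
  exists2 mu, IRC a mu & mu (stratum i) = 1%E.
Proof.
move=> [lambda ilambda]; case: i => [|r].
  exists (dirac_whole hX); first exact: dirac_whole_IRC.
  by rewrite /dirac_whole /= diracE mem_set.
have [mu [mui mur]] := sample_law_exists hX hC lambda r.
exists mu; first exact: (sample_law_IRC hX hC ilambda mui).
exact: (sample_law_stratum hX hC ha ilambda mui mur).
Qed.

Lemma stratum_disjoint_mass mu i j : mu (stratum i) = 1%E -> i != j ->
  mu (stratum j) = 0%E.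
Proof.
have mS := measurable_stratum hX hC.
move=> mui ij; apply/eqP; rewrite eq_le measure_ge0 andbT.
have <- : mu (~` stratum i) = 0%E by rewrite probability_setC// mui subee.
apply: le_measure; rewrite ?inE//; first exact: measurableC.
move=> A Aj Ai.
have /trivIsetP/(_ i j I I ij)/seteqP[H _] := @trivIset_stratum _ _ hX.
exact: (H A).
Qed.

(** The mixture of the laws carried by the strata, with weights [x], has mass [x i]
on the stratum [i] because the strata are disjoint. *)
Lemma stratum_mass_surj (x : nat -> R) : invariant_probabilities R a !=set0 ->
  simplex R x -> exists2 mu, IRC a mu & stratum_mass mu = x.
Proof.
move=> lam [x0 x1].
have mS := measurable_stratum hX hC.
pose b i : probability (borel (cpt X)) R :=
  sval (cid2 (extreme_IRC_exists i lam)).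
have ib i : IRC a (b i) by rewrite /b; case: cid2.
have bi i : b i (stratum i) = 1%E by rewrite /b; case: cid2.
pose m : {measure set (borel (cpt X)) -> \bar R} :=
  mseries (fun i => mscale (NngNum (x0 i)) (b i)) 0.
have mE B : m B = (\sum_(i <oo) (x i)%:E * b i B)%E by [].
have m1 : m setT = 1%E.
  rewrite mE; apply/cvg_lim => //.
  rewrite (_ : (fun n => _) = EFin \o series x); first exact: cvg_comp x1 _.
  apply/funext => n /=; rewrite /series /= -sumEFin; apply: eq_bigr => i _.
  by rewrite probability_setT mule1.
pose pM := Measure_isProbability.Build _ _ _ m m1.
pose mu : probability (borel (cpt X)) R := HB.pack
  (mseries (fun i => mscale (NngNum (x0 i)) (b i)) 0) pM.
exists mu.
  move=> g B mB; rewrite [LHS]mE [RHS]mE; apply: eq_eseriesr => i _.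
  by rewrite ib.
apply/funext => j; apply: EFin_inj; rewrite stratum_massK [LHS]mE.
rewrite (@nneseriesD1 _ _ j)//; last by move=> k _; rewrite mule_ge0// lee_fin.
rewrite bi mule1 eseries0 ?adde0// => k _ /andP[_ kj].
by rewrite (stratum_disjoint_mass (bi k) kj) mule0.
Qed.

End isomorphism.

Theorem theorem1p1 (R : realType) (X : pmetricType R) (hX : cantor_like X)
    (G : groupType) (hG : countable [set: G]) (a : action G X)
    (ha : deeply_transitive a) :
  [/\ IC_rigid hX a,
      invariant_probabilities R a = set0 ->
        uniquely_ergodic_at (hyper_action a) (dirac_whole hX) &
      invariant_probabilities R a !=set0 ->
        affinely_isomorphic (invariant_probabilities R (hyper_action a))
          (simplex R)].
Proof.
have [C hC haC] := ha; split.
- exact: (IC_rigid_of_tree hX hC haC).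
- move=> noinv; split; first exact: dirac_whole_IRC.
  move=> nu inu; apply/(IC_rigid_of_tree hX hC haC); split => //.
  have mS r := measurable_stratum hX hC r.+1.
  rewrite /nonfinitary (finite_cpts_strata hX hC).
  apply/negligibleP; first exact: bigcupT_measurable.
  apply: negligible_bigcup => r; apply/negligibleP => //.
  apply/eqP/negPn/negP => nuE.
  by have := invariant_of_stratum hC inu nuE; rewrite noinv => -[].
- move=> inv; exists (stratum_mass hX); split.
  + by move=> mu; exact: (stratum_mass_simplex hX hC haC).
  + by move=> mu nu; exact: (stratum_mass_inj hX hC haC).
  + by move=> x; exact: (stratum_mass_surj hX hC haC).
  + by move=> t mu nu _ _ i; exact: (stratum_mass_conv hX hC).
Qed.
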